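(* Let $\mathscr{H}^Q$ and $\mathscr{H}^{Q'}$ be finite-dimensional Hilbert spaces with $d:=\dim\mathscr{H}^Q$ and $d':=\dim\mathscr{H}^{Q'}$. Let $\rho^Q$ be a state (density matrix) on $\mathscr{H}^Q$ and let $\mathcal{E}$ be a channel (completely positive trace-preserving linear map) from states on $\mathscr{H}^Q$ to states on $\mathscr{H}^{Q'}$. Let $|\Psi^{RQ}\rangle\in\mathscr{H}^R\otimes\mathscr{H}^Q$ be a purification of $\rho^Q$ (i.e. $\operatorname{Tr}_R[|\Psi\rangle\langle\Psi|^{RQ}]=\rho^Q$), with $\dim\mathscr{H}^R=\dim\mathscr{H}^Q$, and set $\rho^{RQ'}:=(\mathrm{id}^R\otimes\mathcal{E})(|\Psi\rangle\langle\Psi|^{RQ})$. Define $\varepsilon_{\mathrm f}:=S(\rho^Q)-E_{\mathrm f}(\rho^{RQ'})$. Then there exists a channel $\mathcal{R}$ from states on $\mathscr{H}^{Q'}$ to states on $\mathscr{H}^Q$ such that $$F(\rho^Q,\mathcal{R}\circ\mathcal{E})\ \ge\ 1-\sqrt{2(2dd'-1)^2\,\varepsilon_{\mathrm f}}.$$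
   Context: $S(\sigma):=-\operatorname{Tr}[\sigma\log_2\sigma]$ is the von Neumann entropy. The entanglement fidelity of a state $\rho^Q$ and a channel $\mathcal{M}$ from states on $\mathscr{H}^Q$ to states on $\mathscr{H}^Q$ is $F(\rho^Q,\mathcal{M}):=\langle\Psi^{RQ}|(\mathrm{id}^R\otimes\mathcal{M})(|\Psi\rangle\langle\Psi|^{RQ})|\Psi^{RQ}\rangle$, where $|\Psi^{RQ}\rangle$ is any purification of $\rho^Q$ (the value is independent of the choice). For a bipartite state $\sigma^{AB}$, the entanglement of formation is $E_{\mathrm f}(\sigma^{AB}):=\min\sum_ip_iS(\operatorname{Tr}_B[\phi_i^{AB}])$, the minimum being over all decompositions $\sigma^{AB}=\sum_ip_i\phi_i^{AB}$ into pure states $\phi_i^{AB}$ with probabilities $p_i$. *)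

(* Defs.v *)
From HB Require Import structures.
From mathcomp Require Import all_boot all_order all_algebra.
From mathcomp Require Import complex mxtens.
From mathcomp Require Import boolp classical_sets reals exp.

Set Implicit Arguments.
Unset Strict Implicit.
Unset Printing Implicit Defensive.

Import Order.TTheory GRing.Theory Num.Theory.
Local Open Scope ring_scope.
Local Open Scope classical_set_scope.

Section QInfo.
Variable R : realType.
Local Notation C := (R[i]).

Definition adj {m n : nat} (A : 'M[C]_(m, n)) : 'M[C]_(n, m) :=
  map_mx (@conjc R) A^T.

Definition psd {n : nat} (A : 'M[C]_n) : Prop :=
  A = adj A /\ forall x : 'cV[C]_n, 0 <= (adj x *m A *m x) 0 0.

Definition density {n : nat} (A : 'M[C]_n) : Prop := psd A /\ \tr A = 1.

Definition proj {n : nat} (psi : 'cV[C]_n) : 'M[C]_n := psi *m adj psi.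

Definition unit_vec {n : nat} (psi : 'cV[C]_n) : Prop := adj psi *m psi = 1%:M.

(* On H^A (x) H^B = C^(m*n), the basis vector |a>|b> has index
   mxtens_index (a, b) (same convention as the Kronecker product *t). *)

Definition ptrace1 {m n : nat} (X : 'M[C]_(m * n)) : 'M[C]_n :=
  \matrix_(a, b) \sum_(i < m) X (mxtens_index (i, a)) (mxtens_index (i, b)).

Definition ptrace2 {m n : nat} (X : 'M[C]_(m * n)) : 'M[C]_m :=
  \matrix_(a, b) \sum_(j < n) X (mxtens_index (a, j)) (mxtens_index (b, j)).

Definition mxblock_ij {m n : nat} (X : 'M[C]_(m * n)) (i j : 'I_m) : 'M[C]_n :=
  \matrix_(a, b) X (mxtens_index (i, a)) (mxtens_index (j, b)).

Definition idtens {m n n' : nat} (E : 'M[C]_n -> 'M[C]_n') (X : 'M[C]_(m * n))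
  : 'M[C]_(m * n') :=
  \sum_(i < m) \sum_(j < m) (delta_mx i j *t E (mxblock_ij X i j)).

Definition is_channel {n n' : nat} (E : 'M[C]_n -> 'M[C]_n') : Prop :=
  [/\ linear E,
      (forall (m : nat) (X : 'M[C]_(m * n)), psd X -> psd (idtens E X))
    & (forall X : 'M[C]_n, \tr (E X) = \tr X)].

Definition eigenvalues {n : nat} (A : 'M[C]_n) : seq C :=
  sval (closed_field_poly_normal (char_poly A)).

Definition log2 (x : R) : R := ln x / ln 2.

(* von Neumann entropy S(s) = - Tr[s log2 s] = - sum_lambda lambda log2 lambda
   (convention 0 log 0 = 0; eigenvalues of a state are real) *)
Definition entropy {n : nat} (A : 'M[C]_n) : R :=
  - \sum_(z <- eigenvalues A) (complex.Re z * log2 (complex.Re z)).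

(* entanglement of formation of s on H^A (x) H^B (inf over all pure-state
   decompositions; the infimum is attained, so this is the min) *)
Definition ent_formation {m n : nat} (s : 'M[C]_(m * n)) : R :=
  inf [set x : R | exists (k : nat) (p : 'I_k -> R) (psi : 'I_k -> 'cV[C]_(m * n)),
        [/\ (forall l, 0 <= p l), \sum_(l < k) p l = 1,
            (forall l, unit_vec (psi l)),
            s = \sum_(l < k) ((p l)%:C)%C *: proj (psi l)
          & x = \sum_(l < k) p l * entropy (ptrace2 (proj (psi l)))]].

(* entanglement fidelity <Psi| (id (x) M)(|Psi><Psi|) |Psi>, computed with a
   purification Psi in H^R (x) H^Q *)
Definition ent_fidelity {r n : nat} (Psi : 'cV[C]_(r * n))
  (M : 'M[C]_n -> 'M[C]_n) : C :=
  (adj Psi *m idtens M (proj Psi) *m Psi) 0 0.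

End QInfo.

(* Main.v *)
(** The environment of the channel is traced through the spectral decomposition
    [s = sum_e lam_e |u_e><u_e|] of the state [s] on [RQ'], written as [d x d']
    matrices [A_e] with [sum_e A_e A_e^* = rho^R].  The joint state of [R] and
    the environment has blocks [A_e A_f^*]; call [X] its difference with
    the product [rho^R (x) diag lam].

    Every pure-state decomposition of [s] is a measurement of the environment,
    and its Holevo quantity is at most [eps_f]; so by Pinsker's inequality no
    rank-one measurement moves [rho^R] by more than [sqrt (2 eps_f)] on average
    in trace norm.  Two such measurements suffice to control [X]: random phase
    vectors see its off-diagonal blocks (up to a factor [D = d d']), and the
    eigenbasis sees the diagonal ones.  Hence [|X|_1 <= (D + 1) sqrt (2 eps_f)],
    and [D + 1 <= 2 D - 1] unless [D = 1], where [X = 0].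

    By the Powers-Stormer inequality the square roots of the two states then
    have overlap at least [1 - |X|_1 / 2], and factoring these roots through
    the purifications, as in Uhlmann's theorem, produces the Kraus operators of
    the recovery channel.  The trace norm itself is never needed: it only
    occurs tested against contractions. *)

Require Import Defs.
From HB Require Import structures.
From mathcomp Require Import all_boot all_order all_algebra.
From mathcomp Require Import ring lra.
From mathcomp Require Import complex mxtens.
From mathcomp Require Import boolp classical_sets reals exp.

Set Implicit Arguments.
Unset Strict Implicit.
Unset Printing Implicit Defensive.

Import Order.TTheory GRing.Theory Num.Theory.
Local Open Scope ring_scope.
Local Open Scope complex_scope.

(** * Contractions and positive semidefinite matrices *)

Section Matrices.
Variable R : realType.
Local Notation C := (R[i]).

Lemma ler_of_eq (x y : R) : x = y -> x <= y.
Proof. by move=> ->. Qed.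

(** * Squared moduli and Cauchy-Schwarz inequalities *)

Definition nsq (z : C) : R := complex.Re z ^+ 2 + complex.Im z ^+ 2.

Lemma nsqE (z : C) : z * conjc z = (nsq z)%:C.
Proof. by case: z => a b; apply/eqP; rewrite eq_complex /nsq /=; apply/andP; split; apply/eqP; ring. Qed.

Lemma nsq_ge0 z : 0 <= nsq z.
Proof. by rewrite addr_ge0 // sqr_ge0. Qed.

Lemma nsqM x y : nsq (x * y) = nsq x * nsq y.
Proof. by case: x y => a b [c d]; rewrite /nsq /=; ring. Qed.

Lemma nsqJ z : nsq (conjc z) = nsq z.
Proof. by case: z => a b; rewrite /nsq /= sqrrN. Qed.

Lemma nsqC (x : R) : nsq x%:C = x ^+ 2.
Proof. by rewrite /nsq /= expr0n addr0. Qed.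

Lemma nsq0 : nsq 0 = 0.
Proof. by rewrite -[0]/(0%:C) nsqC expr0n. Qed.

Lemma nsq1 : nsq 1 = 1.
Proof. by rewrite -[1]/(1%:C) nsqC expr1n. Qed.

Lemma nsq_eq0 z : nsq z = 0 -> z = 0.
Proof.
by move=> h; apply/eqP; have := nsqE z; rewrite h => /eqP; rewrite mulf_eq0 conjc_eq0 orbb.
Qed.

Lemma sqr_Re_le_nsq z : complex.Re z ^+ 2 <= nsq z.
Proof. by rewrite lerDl sqr_ge0. Qed.

Lemma Re_sum (I : Type) (r : seq I) (P : pred I) (f : I -> C) :
  complex.Re (\sum_(i <- r | P i) f i) = \sum_(i <- r | P i) complex.Re (f i).
Proof. by elim/big_rec2: _ => // i x y _ <-; case: (f i); case: y. Qed.

Lemma ReD (x y : C) : complex.Re (x + y) = complex.Re x + complex.Re y.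
Proof. by case: x; case: y. Qed.

Lemma ReB (x y : C) : complex.Re (x - y) = complex.Re x - complex.Re y.
Proof. by case: x; case: y. Qed.

Lemma ReMl (a : R) (z : C) : complex.Re (a%:C * z) = a * complex.Re z.
Proof. by case: z => x y /=; rewrite mul0r subr0. Qed.

Lemma realc_sum (I : Type) (r : seq I) (P : pred I) (f : I -> R) :
  (\sum_(i <- r | P i) f i)%:C = \sum_(i <- r | P i) (f i)%:C.
Proof. exact: raddf_sum. Qed.

Lemma conjc_sum (I : Type) (r : seq I) (P : pred I) (f : I -> C) :
  conjc (\sum_(i <- r | P i) f i) = \sum_(i <- r | P i) conjc (f i).
Proof. exact: raddf_sum. Qed.

Lemma nsq_sum_mul (I : finType) (f g : I -> C) :
  nsq (\sum_i f i * g i) <= (\sum_i nsq (f i)) * (\sum_i nsq (g i)).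
Proof.
set a := \sum_i nsq (f i); set b := \sum_i nsq (g i); set s := \sum_i f i * g i.
have b0 : 0 <= b by apply: sumr_ge0 => i _; apply: nsq_ge0.
(* The nonnegative sum below expands to [b * (a * b - nsq s)]. *)
have key : b * nsq s <= b * (a * b).
  have : 0 <= \sum_i nsq (b%:C * f i - s * conjc (g i)).
    by apply: sumr_ge0 => i _; apply: nsq_ge0.
  have -> : \sum_i nsq (b%:C * f i - s * conjc (g i)) =
      \sum_i (b ^+ 2 * nsq (f i) + nsq s * nsq (g i)
              - (b *+ 2) * complex.Re (conjc s * (f i * g i))).
    apply: eq_bigr => i _.
    by case: (f i) (g i) s => [x y] [z t] [u v]; rewrite /nsq /=; ring.
  rewrite big_split /= big_split /= -!mulr_sumr -/a -/b sumrN -mulr_sumr -Re_sum -mulr_sumr -/s.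
  rewrite mulrC -/s [conjc s * s]mulrC nsqE /= => h.
  by rewrite -subr_ge0; apply: le_trans h _; apply: ler_of_eq; ring.
have [b_eq0|b_neq0] := eqVneq b 0.
  have g0 i : g i = 0.
    apply: nsq_eq0; apply/eqP; rewrite eq_le nsq_ge0 andbT -b_eq0 /b (bigD1 i) //= lerDl.
    by apply: sumr_ge0 => j _; apply: nsq_ge0.
  rewrite /s big1 => [|i _]; last by rewrite g0 mulr0.
  by rewrite nsq0 b_eq0 mulr0.
by move: key; rewrite ler_pM2l // lt_neqAle eq_sym b_neq0.
Qed.

Lemma sqr_sum_mul (I : finType) (f g : I -> R) :
  (\sum_i f i * g i) ^+ 2 <= (\sum_i f i ^+ 2) * (\sum_i g i ^+ 2).
Proof.
have := nsq_sum_mul (fun i => (f i)%:C) (fun i => (g i)%:C).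
under eq_bigr do rewrite -rmorphM.
by rewrite -realc_sum nsqC; under [X in _ <= X * _]eq_bigr do rewrite nsqC;
  under [X in _ <= _ * X]eq_bigr do rewrite nsqC.
Qed.

(** Cauchy-Schwarz after moving a factor [Num.sqrt (m i)] from [f] to [g]. Since [0^-1 = 0], [f] has
    to vanish wherever the weight does. *)
Lemma nsq_sum_weighted (I : finType) (f g : I -> C) (m : I -> R) :
  (forall i, 0 <= m i) -> (forall i, m i = 0 -> f i = 0) ->
  nsq (\sum_i f i * g i) <= (\sum_i nsq (f i) / m i) * (\sum_i nsq (g i) * m i).
Proof.
move=> m0 fm.
have -> : \sum_i f i * g i =
    \sum_i (f i * (Num.sqrt (m i))^-1%:C) * (g i * (Num.sqrt (m i))%:C).
  apply: eq_bigr => i _; have [/fm->|mi] := eqVneq (m i) 0; first by rewrite !mul0r.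
  rewrite mulrACA -rmorphM mulVf ?mulr1 // sqrtr_eq0 -ltNge lt_neqAle eq_sym mi.
  exact: m0.
apply: le_trans (nsq_sum_mul _ _) _; apply: ler_of_eq; congr (_ * _); apply: eq_bigr => i _.
  by rewrite nsqM nsqC exprVn sqr_sqrtr.
by rewrite nsqM nsqC sqr_sqrtr.
Qed.

(** * Adjoints and the Hilbert-Schmidt norm *)

Lemma adjE m n (A : 'M[C]_(m, n)) i j : adj A i j = conjc (A j i).
Proof. by rewrite !mxE. Qed.

Lemma adjK m n (A : 'M[C]_(m, n)) : adj (adj A) = A.
Proof. by apply/matrixP => i j; rewrite !adjE conjcK. Qed.

Lemma adjM m n p (A : 'M[C]_(m, n)) (B : 'M[C]_(n, p)) :
  adj (A *m B) = adj B *m adj A.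
Proof. by rewrite /adj trmx_mul map_mxM. Qed.

Lemma adjB m n (A B : 'M[C]_(m, n)) : adj (A - B) = adj A - adj B.
Proof. by apply/matrixP => i j; rewrite !mxE rmorphB. Qed.

Lemma adjZ m n a (A : 'M[C]_(m, n)) : adj (a *: A) = conjc a *: adj A.
Proof. by apply/matrixP => i j; rewrite !mxE rmorphM. Qed.

Lemma adj_sum m n (I : Type) (r : seq I) (P : pred I) (A : I -> 'M[C]_(m, n)) :
  adj (\sum_(i <- r | P i) A i) = \sum_(i <- r | P i) adj (A i).
Proof.
apply/matrixP => i j; rewrite adjE !summxE conjc_sum.
by apply: eq_bigr => k _; rewrite adjE.
Qed.

Lemma adj1 n : adj (1%:M : 'M[C]_n) = 1%:M.
Proof. by apply/matrixP => i j; rewrite !mxE conjc_nat eq_sym. Qed.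

Lemma adj_diag n (a : 'I_n -> R) :
  adj (diag_mx (\row_i (a i)%:C)) = diag_mx (\row_i (a i)%:C).
Proof.
by apply/matrixP => i j; rewrite !mxE eq_sym; case: eqP => [->|_]; rewrite ?mulr1n ?conjc_real.
Qed.

Definition sqn m n (A : 'M[C]_(m, n)) : R := \sum_i \sum_j nsq (A i j).

Lemma sqn_ge0 m n (A : 'M[C]_(m, n)) : 0 <= sqn A.
Proof. by do 2![apply: sumr_ge0 => ? _]; apply: nsq_ge0. Qed.

Lemma sqnE m n (A : 'M[C]_(m, n)) : (sqn A)%:C = \tr (A *m adj A).
Proof.
rewrite /sqn realc_sum; apply: eq_bigr => i _; rewrite realc_sum mxE.
by apply: eq_bigr => j _; rewrite adjE nsqE.
Qed.

Lemma sqnEl m n (A : 'M[C]_(m, n)) : (sqn A)%:C = \tr (adj A *m A).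
Proof. by rewrite mxtrace_mulC sqnE. Qed.

Lemma sqn_eq m n p q (A : 'M[C]_(m, n)) (B : 'M[C]_(p, q)) :
  \tr (adj A *m A) = \tr (adj B *m B) -> sqn A = sqn B.
Proof. by move=> h; apply: (@complexI R); rewrite !sqnEl. Qed.

Lemma sqn_cV n (x : 'cV[C]_n) : sqn x = \sum_i nsq (x i 0).
Proof. by apply: eq_bigr => i _; rewrite big_ord1. Qed.

Lemma sqn_cVE n (x : 'cV[C]_n) : (adj x *m x) 0 0 = (sqn x)%:C.
Proof. by rewrite sqnEl /mxtrace big_ord1. Qed.

Lemma sqn_conj m n (A : 'M[C]_(m, n)) : sqn (map_mx conjc A) = sqn A.
Proof. by apply: eq_bigr => i _; apply: eq_bigr => j _; rewrite mxE nsqJ. Qed.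

Lemma sqn_delta n (j : 'I_n) : sqn (delta_mx j 0 : 'cV[C]_n) = 1.
Proof.
rewrite sqn_cV (bigD1 j) //= mxE !eqxx nsq1 big1 ?addr0 // => i ij.
by rewrite mxE (negPf ij) nsq0.
Qed.

Lemma nsq_mulmx_adj n (x y : 'cV[C]_n) : nsq ((adj x *m y) 0 0) <= sqn x * sqn y.
Proof.
rewrite mxE; apply: le_trans (nsq_sum_mul _ _) _; rewrite !sqn_cV.
by under [X in X * _ <= _]eq_bigr do rewrite adjE nsqJ.
Qed.

(** Operator norm at most 1. Traces against contractions stand in for the trace norm. *)
Definition contraction m n (W : 'M[C]_(m, n)) :=
  forall x : 'cV[C]_n, sqn (W *m x) <= sqn x.

Lemma contraction_mul m n p (A : 'M[C]_(m, n)) (B : 'M[C]_(n, p)) :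
  contraction A -> contraction B -> contraction (A *m B).
Proof. by move=> hA hB x; rewrite -mulmxA; apply: le_trans (hA _) (hB _). Qed.

(** With [y = adj A *m x], the inner product of [A *m y] and [x] is [sqn y]. Cauchy-Schwarz gives
    [sqn y ^+ 2 <= sqn y * sqn x], and one factor cancels. *)
Lemma contraction_adj m n (A : 'M[C]_(m, n)) : contraction A -> contraction (adj A).
Proof.
move=> hA x; set y := adj A *m x.
have := nsq_mulmx_adj (A *m y) x.
rewrite adjM -mulmxA -/y sqn_cVE nsqC => h.
have {h} := le_trans h (ler_wpM2r (sqn_ge0 x) (hA y)).
have [->|y0] := eqVneq (sqn y) 0; first by rewrite sqn_ge0.
by rewrite expr2 ler_pM2l // lt_neqAle eq_sym y0 sqn_ge0.
Qed.

Lemma contraction_conj m n (A : 'M[C]_(m, n)) :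
  contraction A -> contraction (map_mx conjc A).
Proof.
move=> hA x.
have xE : x = map_mx conjc (map_mx conjc x).
  by apply/matrixP => i j; rewrite !mxE conjcK.
by rewrite xE -map_mxM !sqn_conj; have := hA (map_mx conjc x); rewrite sqn_conj.
Qed.

Lemma contraction_isometry m n (A : 'M[C]_(m, n)) : adj A *m A = 1%:M -> contraction A.
Proof.
move=> h x; apply: ler_of_eq; apply: sqn_eq.
by rewrite adjM -mulmxA (mulmxA (adj A)) h mul1mx.
Qed.

Lemma contraction_col m n (A : 'M[C]_(m, n)) j :
  contraction A -> \sum_i nsq (A i j) <= 1.
Proof.
move=> hA; have := hA (delta_mx j 0); rewrite sqn_delta sqn_cV.
by rewrite -colE; under eq_bigr do rewrite mxE.
Qed.

Lemma contraction_row m n (A : 'M[C]_(m, n)) i :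
  contraction A -> \sum_j nsq (A i j) <= 1.
Proof.
move=> /contraction_adj/(contraction_col i); under eq_bigr do rewrite adjE nsqJ.
by [].
Qed.

(** * Spectral decompositions, square roots and the Powers-Stormer inequality *)

Lemma hermitian_spectral n (A : 'M[C]_n) : A = adj A ->
  exists V : 'M[C]_n, exists a : 'I_n -> R,
    [/\ adj V *m V = 1%:M, V *m adj V = 1%:M
      & A = V *m diag_mx (\row_i (a i)%:C) *m adj V].
Proof.
move=> hA.
have adjt m p (B : 'M[C]_(m, p)) : adj B = map_mx Num.conj B^T.
  by [].
have hh : A \is hermsymmx.
  by apply/is_hermitianmxP; rewrite expr0 scale1r {1}hA adjt.
have /mxOverP aR := hermitian_spectral_diag_real hh.
have /orthomx_spectralP AE := hermitian_normalmx hh.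
have U := spectral_unitarymx A.
have UI := invmx_unitary U.
set P := spectralmx A in AE U UI; set sp := spectral_diag A in AE aR.
have PP : P *m adj P = 1%:M by apply/unitarymxP.
exists (adj P), (fun i => complex.Re (sp 0 i)); split.
- by rewrite adjK.
- by rewrite adjK; apply: mulmx1C.
rewrite adjK {1}AE UI adjt; congr (_ *m diag_mx _ *m _).
by apply/rowP => i; rewrite mxE RRe_real.
Qed.

Lemma diag_conj_entry n (V : 'M[C]_n) (a : 'I_n -> R) i j :
  (V *m diag_mx (\row_k (a k)%:C) *m adj V) i j =
  \sum_k (a k)%:C * V i k * conjc (V j k).
Proof.
rewrite mxE; apply: eq_bigr => k _; rewrite mul_mx_diag !mxE.
by rewrite [V i k * _]mulrC.
Qed.

Lemma psd_diag_ge0 n (A : 'M[C]_n) (V : 'M[C]_n) i : psd A ->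
  0 <= complex.Re ((adj V *m A *m V) i i).
Proof.
case=> _ /(_ (col i V)); rewrite lecE => /andP[_].
suff -> : (adj (col i V) *m A *m col i V) 0 0 = (adj V *m A *m V) i i by [].
rewrite !mxE; apply: eq_bigr => j _; rewrite !mxE; congr (_ * _).
by apply: eq_bigr => k _; rewrite !mxE.
Qed.

Lemma psd_spectral n (A : 'M[C]_n) : psd A ->
  exists V : 'M[C]_n, exists a : 'I_n -> R,
    [/\ adj V *m V = 1%:M, V *m adj V = 1%:M, forall i, 0 <= a i
      & A = V *m diag_mx (\row_i (a i)%:C) *m adj V].
Proof.
move=> pA; have [V [a [VV VV' AE]]] := hermitian_spectral pA.1.
exists V, a; split => // i.
have := psd_diag_ge0 V i pA.
rewrite AE !mulmxA VV mul1mx -mulmxA VV mulmx1 !mxE eqxx mulr1n.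
by [].
Qed.

Lemma psd_mul_adj m n (B : 'M[C]_(m, n)) : psd (B *m adj B).
Proof.
split; first by rewrite adjM adjK.
move=> x; rewrite mulmxA -mulmxA -[X in X *m _]adjK adjM adjK sqn_cVE ler0c.
exact: sqn_ge0.
Qed.

Lemma psd_sum n (I : finType) (A : I -> 'M[C]_n) :
  (forall i, psd (A i)) -> psd (\sum_i A i).
Proof.
move=> pA; split; first by rewrite adj_sum; apply: eq_bigr => i _; case: (pA i).
move=> x; rewrite mulmx_sumr mulmx_suml summxE.
by apply: sumr_ge0 => i _; case: (pA i).
Qed.

Lemma psd_conj_diag n (V : 'M[C]_n) (a : 'I_n -> R) : (forall i, 0 <= a i) ->
  psd (V *m diag_mx (\row_i (a i)%:C) *m adj V).
Proof.
move=> a0; set S := V *m diag_mx (\row_i (Num.sqrt (a i))%:C).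
suff -> : V *m diag_mx (\row_i (a i)%:C) *m adj V = S *m adj S by apply: psd_mul_adj.
rewrite /S adjM adj_diag mulmxA -(mulmxA V (diag_mx _) (diag_mx _)) mulmx_diag.
congr (_ *m diag_mx _ *m _).
by apply/rowP => i; rewrite !mxE -rmorphM -expr2 sqr_sqrtr.
Qed.

Lemma tr_conj_diag n (V : 'M[C]_n) (a : 'I_n -> R) : adj V *m V = 1%:M ->
  \tr (V *m diag_mx (\row_i (a i)%:C) *m adj V) = (\sum_i a i)%:C.
Proof.
move=> VV; rewrite mxtrace_mulC mulmxA VV mul1mx realc_sum.
by apply: eq_bigr => i _; rewrite !mxE eqxx mulr1n.
Qed.

Lemma psd_sqrt n (A : 'M[C]_n) : psd A -> exists2 S : 'M[C]_n, psd S & S *m S = A.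
Proof.
move=> /psd_spectral[V [a [VV _ a0 ->]]].
exists (V *m diag_mx (\row_i (Num.sqrt (a i))%:C) *m adj V).
  by apply: psd_conj_diag => i; apply: sqrtr_ge0.
rewrite -!mulmxA (mulmxA (adj V) V) VV mul1mx (mulmxA (diag_mx _)) mulmx_diag.
rewrite !mulmxA; congr (_ *m diag_mx _ *m _).
by apply/rowP => i; rewrite !mxE -rmorphM -expr2 sqr_sqrtr.
Qed.

Lemma contraction_diag n (a : 'I_n -> R) : (forall i, a i ^+ 2 <= 1) ->
  contraction (diag_mx (\row_i (a i)%:C)).
Proof.
move=> a1 x; rewrite !sqn_cV; apply: ler_sum => i _.
by rewrite mul_diag_mx !mxE nsqM nsqC ler_piMl // nsq_ge0.
Qed.

(* Douglas factorization: the contraction is [adj B] times the pseudo-inverse of [S]. *)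
Lemma sqrt_factor m n (B : 'M[C]_(m, n)) (S : 'M[C]_m) :
  psd S -> S *m S = B *m adj B ->
  exists2 U : 'M[C]_(n, m), contraction U & S = B *m U.
Proof.
move=> /psd_spectral[V [s [VV VV' s0 SE]]] SS.
have [T TE] : {T | T = V *m diag_mx (\row_i (s i)^-1%:C)} by eexists.
(* Because [0^-1 = 0], [T *m adj V] is the pseudo-inverse of [S] and undoes one factor even if [S]
   has a kernel. *)
have ST : S *m S *m T *m adj V = S.
  rewrite SE TE -!mulmxA (mulmxA (adj V) V) VV mul1mx.
  rewrite (mulmxA (adj V) V) VV mul1mx (mulmxA (diag_mx _) (diag_mx _) (adj V)).
  rewrite mulmx_diag (mulmxA (diag_mx _) (diag_mx _) (adj V)) mulmx_diag.
  congr (_ *m (diag_mx _ *m _)).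
  apply/rowP => i; rewrite !mxE -!rmorphM; congr (_%:C).
  by have [->|si] := eqVneq (s i) 0; rewrite ?mul0r // mulrCA mulfV ?mulr1.
exists (adj B *m T *m adj V); last by rewrite !mulmxA -SS ST.
apply: contraction_mul; last by apply: contraction_isometry; rewrite adjK.
(* As [B *m adj B = S *m S], the Gram matrix of [adj B *m T] is the 0-1 diagonal marking the support
   of [S]. *)
suff h : adj (adj B *m T) *m (adj B *m T) =
    adj (diag_mx (\row_i (s i * (s i)^-1)%:C)) *m diag_mx (\row_i (s i * (s i)^-1)%:C).
  have hc : contraction (diag_mx (\row_i (s i * (s i)^-1)%:C)).
    apply: contraction_diag => i; have [->|si] := eqVneq (s i) 0.
      by rewrite mul0r expr0n.
    by rewrite mulfV ?expr1n.
  move=> x; apply: le_trans (hc x); apply: ler_of_eq; apply: sqn_eq.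
  by rewrite !adjM -[LHS]/(\tr (_ *m _ *m _)) -!mulmxA !(mulmxA (adj x)) -!mulmxA
    (mulmxA (adj (diag_mx _))) -h adjM -!mulmxA.
rewrite adjM adjK -mulmxA (mulmxA B) -SS SE TE adjM !adj_diag.
rewrite -!mulmxA !(mulmxA (adj V) V) VV !mul1mx.
rewrite !mulmx_diag; congr diag_mx.
by apply/rowP => i; rewrite !mxE -!rmorphM; congr (_%:C); rewrite -expr2; ring.
Qed.

(** For [U] the sign of [S - T], the right side is the trace of [|S - T| (S + T)]. In an eigenbasis
    of [S - T] each eigenvalue is a difference [x - y] of nonnegative diagonal entries, and
    [|x - y| (x + y) >= (x - y)^2]. *)
Lemma powers_stormer n (S T : 'M[C]_n) : psd S -> psd T ->
  exists2 U : 'M[C]_n, contraction U &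
    complex.Re (\tr ((S - T) *m (S - T))) <= complex.Re (\tr (U *m (S *m S - T *m T))).
Proof.
move=> pS pT.
have hD : S - T = adj (S - T) by rewrite adjB -pS.1 -pT.1.
have [V [a [VV VV' DE]]] := hermitian_spectral hD.
pose sg i : R := if 0 <= a i then 1 else -1.
pose U := V *m diag_mx (\row_i (sg i)%:C) *m adj V.
pose abs_ := V *m diag_mx (\row_i (sg i * a i)%:C) *m adj V.
have UD : U *m (S - T) = abs_.
  rewrite DE /U -!mulmxA (mulmxA (adj V) V) VV mul1mx (mulmxA (diag_mx _)) mulmx_diag mulmxA.
  by congr (_ *m diag_mx _ *m _); apply/rowP => i; rewrite !mxE -rmorphM.
have DU : (S - T) *m U = abs_.
  rewrite DE /U -!mulmxA (mulmxA (adj V) V) VV mul1mx (mulmxA (diag_mx _)) mulmx_diag mulmxA.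
  by congr (_ *m diag_mx _ *m _); apply/rowP => i; rewrite !mxE -rmorphM mulrC.
exists U.
  apply: contraction_mul; last by apply: contraction_isometry; rewrite adjK.
  apply: contraction_mul; first exact: contraction_isometry.
  by apply: contraction_diag => i; rewrite /sg; case: ifP; rewrite ?sqrrN expr1n.
(* Symmetrizing exposes a factor [S - T]; [U] commutes with it, so both halves have the same trace
   against [U]. *)
have E2 : (S *m S - T *m T) *+ 2 = (S - T) *m (S + T) + (S + T) *m (S - T).
  rewrite !(mulmxDl, mulmxDr, mulNmx, mulmxN) mulr2n.
  rewrite !addrA; do !rewrite -?addrA; rewrite [S *m S + _]addrC.
  rewrite !addrA addrC !addrA.
  by apply/matrixP => i j; rewrite !mxE; ring.
have tE : \tr (U *m (S *m S - T *m T)) = \tr (abs_ *m (S + T)).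
  have half (x y : C) : x + x = y *+ 2 -> x = y.
    by case: x y => x1 x2 [y1 y2]; rewrite mulr2n => -[h1 h2]; congr Complex; lra.
  apply: half; rewrite -mxtraceD -mulmxDr -mulr2n.
  rewrite E2 mulmxDr mxtraceD !mulmxA UD mulr2n; congr (_ + _).
  by rewrite mxtrace_mulC mulmxA DU.
have diagtr (f : 'I_n -> R) (M : 'M[C]_n) :
    \tr (V *m diag_mx (\row_i (f i)%:C) *m adj V *m M) =
    \sum_i (f i)%:C * (adj V *m M *m V) i i.
  rewrite -!mulmxA mxtrace_mulC -!mulmxA; apply: eq_bigr => i _.
  by rewrite mul_diag_mx [LHS]mxE [X in X * _]mxE mulmxA.
rewrite tE {1}DE !diagtr !Re_sum; apply: ler_sum => i _; rewrite !ReMl.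
have hS := psd_diag_ge0 V i pS; have hT := psd_diag_ge0 V i pT.
have aE : a i = complex.Re ((adj V *m (S - T) *m V) i i).
  by rewrite DE !mulmxA VV mul1mx -mulmxA VV mulmx1 !mxE eqxx mulr1n.
have entB (P Q : 'M[C]_n) : (P - Q) i i = P i i - Q i i by rewrite !mxE.
have entD (P Q : 'M[C]_n) : (P + Q) i i = P i i + Q i i by rewrite !mxE.
move: aE; rewrite mulmxBr mulmxBl mulmxDr mulmxDl entB entD ReB ReD.
rewrite /sg; set x := complex.Re _; set y := complex.Re _.
move: hS hT; rewrite -/x -/y => hS hT aE.
by case: ifPn => [a0|]; [nra | rewrite -ltNge => a0; nra].
Qed.

End Matrices.

(** * Entropy and Pinsker's inequality *)

Section Entropy.
Variable R : realType.
Local Notation C := (R[i]).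

(** Two block eliminations of the same matrix [M]; the second one carries a factor ['X ^+ n], which
    cancels as a nonzero polynomial. *)
Lemma char_poly_mulC (F : fieldType) n (A B : 'M[F]_n) :
  char_poly (A *m B) = char_poly (B *m A).
Proof.
rewrite /char_poly /char_poly_mx !map_mxM.
set a := map_mx polyC A; set b := map_mx polyC B.
pose M := block_mx ('X%:M : 'M[{poly F}]_n) a b 1%:M.
have h1 : \det M = \det ('X%:M - a *m b).
  have <- : \det (block_mx 1%:M (- a) 0 1%:M *m M) = \det M.
    by rewrite det_mulmx det_ublock !det1 !mul1r.
  rewrite mulmx_block !mul1mx !mul0mx !mulmx1 !add0r mulNmx subrr det_lblock det1 mulr1.
  by [].
have h2 : 'X ^+ n * \det M = 'X ^+ n * \det ('X%:M - b *m a).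
  have <- : \det (block_mx 1%:M 0 (- b) 'X%:M *m M) = 'X ^+ n * \det M.
    by rewrite det_mulmx det_lblock det1 mul1r det_scalar.
  rewrite mulmx_block !mul1mx !mul0mx !mulmx1 !addr0 !mulNmx.
  by rewrite mul_mx_scalar mul_scalar_mx addNr det_ublock det_scalar [- _ + _]addrC.
rewrite -h1; apply: (mulfI _ h2).
by rewrite expf_neq0 // polyX_eq0.
Qed.

Lemma char_poly_trmx (F : fieldType) n (A : 'M[F]_n) : char_poly A^T = char_poly A.
Proof.
by rewrite /char_poly /char_poly_mx -[in RHS]det_tr linearB /= tr_scalar_mx map_trmx.
Qed.

Lemma entropy_char_poly n (A B : 'M[C]_n) : char_poly A = char_poly B -> entropy A = entropy B.
Proof. by rewrite /entropy /eigenvalues => ->. Qed.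

(** [eigenvalues] is a chosen list of roots of the characteristic polynomial, so it is determined
    only up to order; unique factorization matches it with the [a i]. *)
Lemma entropy_diag n (V : 'M[C]_n) (a : 'I_n -> R) : adj V *m V = 1%:M ->
  entropy (V *m diag_mx (\row_i (a i)%:C) *m adj V) = - \sum_i a i * log2 (a i).
Proof.
move=> VV; set A := V *m _ *m _.
have cE : char_poly A = \prod_(z <- [seq (a i)%:C | i <- enum 'I_n]) ('X - z%:P).
  rewrite /A -mulmxA char_poly_mulC -mulmxA VV mulmx1 char_poly_trig ?diag_mx_is_trig //.
  rewrite big_map big_enum /=; apply: eq_bigr => i _.
  by rewrite !mxE eqxx mulr1n.
rewrite /entropy /eigenvalues; case: closed_field_poly_normal => r /= rE.
have pr : perm_eq r [seq (a i)%:C | i <- enum 'I_n].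
  apply: prod_XsubC_eq; rewrite -cE [RHS]rE.
  by rewrite (eqP (char_poly_monic A)) scale1r.
by rewrite (perm_big _ pr) /= big_map big_enum.
Qed.

Lemma density_spectral n (A : 'M[C]_n) : density A ->
  exists V : 'M[C]_n, exists a : 'I_n -> R,
    [/\ adj V *m V = 1%:M, V *m adj V = 1%:M, forall i, 0 <= a i, \sum_i a i = 1
      & A = V *m diag_mx (\row_i (a i)%:C) *m adj V].
Proof.
move=> [/psd_spectral[V [a [VV VV' a0 AE]]] tA]; exists V, a; split => //.
by apply: (@complexI R); rewrite -(tr_conj_diag a VV) -AE tA.
Qed.

Lemma log2_ln2 (x : R) : ln 2 * log2 x = ln x.
Proof. by rewrite /log2 mulrCA mulfV ?mulr1 // gt_eqF // ln_gt0 // ltr1n. Qed.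

Lemma entropy_ge0 n (A : 'M[C]_n) : density A -> 0 <= entropy A.
Proof.
move=> /density_spectral[V [a [VV _ a0 a1 ->]]].
rewrite entropy_diag // oppr_ge0; apply: sumr_le0 => i _.
rewrite mulr_ge0_le0 // /log2 mulr_le0_ge0 ?invr_ge0 ?ln_ge0 ?ler1n //.
apply: ln_le0; rewrite -a1 (bigD1 i) //= lerDl.
by apply: sumr_ge0.
Qed.

(** * Numerical bounds on logarithms *)

Lemma ln_le_subr1 (x : R) : 0 < x -> ln x <= x - 1.
Proof.
move=> x0; have := @le_ln1Dx R (x - 1); rewrite [1 + _]addrC subrK; apply; lra.
Qed.

(** From [2 <= (209/200)^16] and [ln x <= x - 1] comes [16 * 9/200 = 18/25]. This is twice the
    constant [9/25] of [pinsker], whence the factor 2 in [holevo_pinsker]. *)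
Lemma ln2_le : ln 2 <= 18 / 25 :> R.
Proof.
have h : ln (2 : R) <= ln ((209 / 200) ^+ 16).
  rewrite ler_ln ?posrE ?exprn_gt0 //; lra.
apply: le_trans h _; rewrite lnXn; last lra.
have := @ln_le_subr1 (209 / 200); rewrite -mulr_natl => h; have {h} := h ltac:(lra); lra.
Qed.

Lemma ln_poly_ge0 (s : R) : 0 < s ->
  0 <= 48 * s ^+ 6 - 4 * s ^+ 5 - 56 * s ^+ 4 - 108 * s ^+ 3 + 69 * s ^+ 2 + 46 * s + 23.
Proof.
move=> s0; have [s1|s1] := lerP s 1.
  (* For [s <= 1] every summand of this form is nonnegative. *)
  have -> : 48 * s ^+ 6 - 4 * s ^+ 5 - 56 * s ^+ 4 - 108 * s ^+ 3 + 69 * s ^+ 2 + 46 * s + 23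
    = (48 * s ^+ 4 + 92 * s ^+ 3 + 80 * s ^+ 2) * (s - 1) ^+ 2
      + (11 * s * (1 - s) + 40 * s * (1 - s) * (1 + s) + 5 * (1 - s) + 18) by ring.
  have p k : 0 <= s ^+ k by rewrite exprn_ge0 // ltW.
  apply: addr_ge0; first by rewrite mulr_ge0 ?sqr_ge0 // !addr_ge0 // mulr_ge0.
  rewrite !addr_ge0 // ?mulr_ge0 //; lra.
(* Expanded in [u], only the linear coefficient is negative; the two squares supplied to [lra]
   absorb it. *)
have [u u0 ->] : exists2 u, 0 <= u & s = 1 + u by exists (s - 1); lra.
have p k : 0 <= u ^+ k by rewrite exprn_ge0.
have := p 6; have := p 5; have := p 4; have := p 2.
have := mulr_ge0 u0 (sqr_ge0 (u - 1 / 5)); have := sqr_ge0 (u - 37 / 200); lra.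
Qed.

(* With a/b = s^4 and ln (1/s) <= 1/s - 1, the claim reduces to [ln_poly_ge0]. *)
Lemma rel_entropy_ge (a b : R) : 0 <= a -> 0 < b ->
  9 / 25 * ((a - b) ^+ 2 / ((a + 2 * b) / 3)) <= a * ln a - a * ln b - a + b.
Proof.
rewrite le_eqVlt => /predU1P[<-|a0] b0.
  have -> : 9 / 25 * ((0 - b) ^+ 2 / ((0 + 2 * b) / 3)) = 27 / 50 * b by field; lra.
  by rewrite !mul0r; lra.
have ab0 : 0 < a / b by rewrite divr_gt0.
set s := Num.sqrt (Num.sqrt (a / b)).
have s0 : 0 < s by rewrite !sqrtr_gt0.
have aE : a = b * s ^+ 4.
  have -> : s ^+ 4 = (s ^+ 2) ^+ 2 by rewrite -exprM.
  rewrite sqr_sqrtr ?sqrtr_ge0 // sqr_sqrtr ?ltW //.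
  by rewrite mulrC divfK // gt_eqF.
have lE : ln a = ln b + 4 * ln s.
  by rewrite {1}aE lnM ?posrE ?exprn_gt0 // lnXn // mulr_natl.
have ls : 1 - s^-1 <= ln s.
  have := @ln_le_subr1 s^-1; rewrite invr_gt0 s0 => /(_ isT).
  by rewrite lnV ?posrE //; lra.
have h1 : 4 * (b * (s ^+ 4 - s ^+ 3)) <= a * ln a - a * ln b.
  have -> : a * ln a - a * ln b = 4 * (a * ln s) by rewrite lE; ring.
  rewrite ler_pM2l; last lra.
  have -> : b * (s ^+ 4 - s ^+ 3) = a * (1 - s^-1) by rewrite aE; field; rewrite gt_eqF.
  by rewrite ler_pM2l.
suff : 9 / 25 * ((a - b) ^+ 2 / ((a + 2 * b) / 3)) <= b * (3 * s ^+ 4 - 4 * s ^+ 3 + 1).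
  move=> h; apply: le_trans h _; rewrite [in X in _ <= _ - X + _]aE.
  by move: h1; lra.
have s4 : 0 <= s ^+ 4 by rewrite exprn_ge0 // ltW.
have -> : 9 / 25 * ((a - b) ^+ 2 / ((a + 2 * b) / 3)) =
    b * (27 / 25 * (s ^+ 4 - 1) ^+ 2 / (s ^+ 4 + 2)).
  rewrite aE; field; rewrite gt_eqF; last lra.
  by rewrite gt_eqF //=; have := mulr_ge0 (ltW b0) s4; lra.
rewrite ler_pM2l // ler_pdivrMr; last lra.
rewrite -subr_ge0.
(* Both sides of the claim vanish to second order at [a = b], so [(s - 1) ^+ 2] splits off. *)
have -> : (3 * s ^+ 4 - 4 * s ^+ 3 + 1) * (s ^+ 4 + 2) - 27 / 25 * (s ^+ 4 - 1) ^+ 2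
  = (s - 1) ^+ 2 * (48 * s ^+ 6 - 4 * s ^+ 5 - 56 * s ^+ 4 - 108 * s ^+ 3 + 69 * s ^+ 2 + 46 * s + 23) / 25.
  by field.
by rewrite divr_ge0 // mulr_ge0 ?sqr_ge0 // ln_poly_ge0.
Qed.

(* Quantum Pinsker inequality: expand [\tr (W (A - B))] in the eigenbases of
   [A] and [B] and apply Cauchy-Schwarz with weights [(a_j + 2 b_k) / 3]. *)
Lemma pinsker n (A Y W : 'M[C]_n) (b : 'I_n -> R) :
  density A -> adj Y *m Y = 1%:M -> Y *m adj Y = 1%:M ->
  (forall k, 0 <= b k) -> \sum_k b k = 1 ->
  (forall k, b k = 0 -> complex.Re ((adj Y *m A *m Y) k k) = 0) ->
  contraction W ->
  9 / 25 * nsq (\tr (W *m (A - Y *m diag_mx (\row_k (b k)%:C) *m adj Y))) <=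
  - (ln 2 * entropy A) - \sum_k complex.Re ((adj Y *m A *m Y) k k) * ln (b k).
Proof.
move=> /density_spectral[V [a [VV VV' a0 a1 AE]]] YY YY' b0 b1 supp hW.
set B := Y *m _ *m _.
(* [T] holds the overlaps of the two eigenbases; its squared moduli [w] are doubly stochastic. *)
pose T := adj Y *m V; pose M := adj Y *m W *m V; pose w k j := nsq (T k j).
have TT : adj T *m T = 1%:M by rewrite /T adjM adjK -mulmxA (mulmxA Y) YY' mul1mx.
have TT' : T *m adj T = 1%:M by apply: mulmx1C.
have isoE (Z : 'M[C]_n) j : adj Z *m Z = 1%:M -> \sum_k nsq (Z k j) = 1.
  move=> ZZ; apply: (@complexI R); rewrite realc_sum.
  have := congr1 (fun X : 'M[C]_n => X j j) ZZ; rewrite !mxE eqxx => h.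
  by rewrite -[RHS]h; apply: eq_bigr => k _; rewrite adjE mulrC nsqE.
have wc j : \sum_k w k j = 1 by apply: isoE.
have wr k : \sum_j w k j = 1.
  have := @isoE (adj T) k; rewrite adjK => /(_ TT') <-.
  by apply: eq_bigr => j _; rewrite adjE nsqJ.
have qE k : complex.Re ((adj Y *m A *m Y) k k) = \sum_j w k j * a j.
  have -> : adj Y *m A *m Y = T *m diag_mx (\row_i (a i)%:C) *m adj T.
    by rewrite AE /T adjM adjK !mulmxA.
  rewrite diag_conj_entry Re_sum; apply: eq_bigr => j _.
  by rewrite -mulrA nsqE ReMl mulrC.
have Mcontr : contraction M.
  apply: contraction_mul; last exact: contraction_isometry.
  by apply: contraction_mul => //; apply: contraction_isometry; rewrite adjK.
have trE : \tr (W *m (A - B)) =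
    \sum_(p : 'I_n * 'I_n) ((a p.2 - b p.1)%:C * conjc (T p.1 p.2)) * M p.1 p.2.
  rewrite -(pair_bigA _ (fun k j => ((a j - b k)%:C * conjc (T k j)) * M k j)) /=.
  have -> : \tr (W *m (A - B)) =
      \tr (M *m diag_mx (\row_i (a i)%:C) *m adj T) - \tr (diag_mx (\row_k (b k)%:C) *m M *m adj T).
    rewrite mulmxBr raddfB /=; congr (_ - _).
      rewrite /M /T adjM adjK AE [RHS]mxtrace_mulC -!mulmxA (mulmxA Y) YY' mul1mx.
      by rewrite [RHS]mxtrace_mulC -!mulmxA.
    rewrite /M /T adjM adjK /B -!mulmxA (mulmxA V) VV' mul1mx.
    by rewrite mxtrace_mulC -!mulmxA mxtrace_mulC -!mulmxA.
  rewrite /mxtrace -sumrB; apply: eq_bigr => k _.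
  rewrite !mxE -sumrB; apply: eq_bigr => j _.
  rewrite mul_mx_diag mul_diag_mx !adjE !mxE rmorphB.
  ring.
pose m (p : 'I_n * 'I_n) : R := (a p.2 + 2 * b p.1) / 3.
have m0 p : 0 <= m p by rewrite divr_ge0 // addr_ge0 // mulr_ge0.
have CS : nsq (\tr (W *m (A - B))) <= \sum_k \sum_j w k j * ((a j - b k) ^+ 2 / m (k, j)).
  rewrite trE; apply: le_trans (nsq_sum_weighted _ m0 _) _.
    move=> [k j] /=; rewrite /m /= => mE.
    have := a0 j; have := b0 k => bk aj.
    have -> : a j - b k = 0 by lra.
    by rewrite mul0r.
  (* Rows and columns of the contraction [M] have square sums at most 1, so the total is at most
     [(1 + 2) / 3]. *)
  have h1 : \sum_p nsq (M p.1 p.2) * m p <= 1.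
    rewrite -(pair_bigA _ (fun k j => nsq (M k j) * m (k, j))) /=.
    have -> : \sum_k \sum_j nsq (M k j) * m (k, j) =
        (\sum_k \sum_j nsq (M k j) * a j + 2 * \sum_k \sum_j nsq (M k j) * b k) / 3.
      rewrite mulr_sumr -big_split mulr_suml; apply: eq_bigr => k _.
      rewrite mulr_sumr -big_split mulr_suml; apply: eq_bigr => j _.
      by rewrite /m /=; field.
    have ha : \sum_k \sum_j nsq (M k j) * a j <= 1.
      rewrite exchange_big -a1; apply: ler_sum => j _.
      by rewrite -mulr_suml ler_piMl // contraction_col.
    have hb : \sum_k \sum_j nsq (M k j) * b k <= 1.
      rewrite -b1; apply: ler_sum => k _.
      by rewrite -mulr_suml ler_piMl // contraction_row.
    by lra.
  have -> : \sum_p nsq ((a p.2 - b p.1)%:C * conjc (T p.1 p.2)) / m p =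
     \sum_k \sum_j w k j * ((a j - b k) ^+ 2 / m (k, j)).
    rewrite -(pair_bigA _ (fun k j => nsq ((a j - b k)%:C * conjc (T k j)) / m (k, j))) /=.
    by apply: eq_bigr => k _; apply: eq_bigr => j _; rewrite nsqM nsqC nsqJ mulrAC mulrC mulrA.
  apply: ler_piMr h1; apply: sumr_ge0 => k _; apply: sumr_ge0 => j _.
  by rewrite mulr_ge0 ?nsq_ge0 // divr_ge0 // sqr_ge0.
(* The added [- a j + b k] sums to zero against [w] and gives each summand its own lower bound by
   [rel_entropy_ge]. *)
have -> : - (ln 2 * entropy A) - \sum_k complex.Re ((adj Y *m A *m Y) k k) * ln (b k) =
    \sum_k \sum_j w k j * (a j * ln (a j) - a j * ln (b k) - a j + b k).
  have e1 : ln 2 * entropy A = - \sum_k \sum_j w k j * (a j * ln (a j)).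
    rewrite {1}AE entropy_diag // mulrN mulr_sumr exchange_big; congr (- _).
    by apply: eq_bigr => j _; rewrite -mulr_suml wc mul1r mulrCA log2_ln2.
  have e2 : \sum_k complex.Re ((adj Y *m A *m Y) k k) * ln (b k) =
      \sum_k \sum_j w k j * (a j * ln (b k)).
    by apply: eq_bigr => k _; rewrite qE mulr_suml; apply: eq_bigr => j _; rewrite mulrA.
  have e3 : \sum_k \sum_j w k j * a j = 1.
    by rewrite exchange_big -a1; apply: eq_bigr => j _; rewrite -mulr_suml wc mul1r.
  have e4 : \sum_k \sum_j w k j * b k = 1.
    by rewrite -b1; apply: eq_bigr => k _; rewrite -mulr_suml wr mul1r.
  rewrite e1 opprK e2 -[LHS]addr0 -[X in _ + X](subrr 1) -{1}e4 -e3.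
  rewrite [X in _ + X]addrC addrA -!sumrB -big_split /=; apply: eq_bigr => k _.
  rewrite -!sumrB -big_split /=; apply: eq_bigr => j _; ring.
apply: le_trans (ler_wpM2l _ CS) _; first lra.
rewrite mulr_sumr; apply: ler_sum => k _; rewrite mulr_sumr; apply: ler_sum => j _.
rewrite mulrCA.
have [bk|bk] := eqVneq (b k) 0; last first.
  apply: ler_wpM2l; first exact: nsq_ge0.
  by apply: rel_entropy_ge => //; rewrite lt_neqAle eq_sym bk b0.
(* Here [ln (b k)] is a mere default value; the support hypothesis forces [w k j = 0] or [a j = 0],
   and both sides vanish. *)
have wa : w k j * a j = 0.
  have := supp k bk; rewrite qE => /eqP; rewrite psumr_eq0; last first.
    by move=> i _; rewrite mulr_ge0 ?nsq_ge0.
  by move=> /allP/(_ j); rewrite mem_index_enum => /(_ isT)/eqP.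
move/eqP: wa; rewrite mulf_eq0 => /orP[/eqP ->|/eqP aj]; first by rewrite !mul0r.
by rewrite /m /= aj bk !mul0r subrr expr0n !mul0r !mulr0 !subr0 addr0 mulr0.
Qed.

(** The Holevo quantity is the average relative entropy of the [A t] to their mean [B], so Pinsker's
    inequality applies to each member. *)
Lemma holevo_pinsker n (I : finType) (p : I -> R) (A W : I -> 'M[C]_n) (B : 'M[C]_n) :
  (forall t, 0 <= p t) -> \sum_t p t = 1 -> (forall t, density (A t)) ->
  (forall t, contraction (W t)) ->
  B = \sum_t (p t)%:C *: A t ->
  \sum_t p t * nsq (\tr (W t *m (A t - B))) <=
  2 * (entropy B - \sum_t p t * entropy (A t)).
Proof.
move=> p0 p1 dA cW BD.
have pB : psd B.
  rewrite BD; apply: psd_sum => t; have [[hA pA] _] := dA t.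
  split; first by rewrite adjZ -hA conjc_real.
  by move=> x; rewrite -scalemxAr -scalemxAl mxE mulr_ge0 ?ler0c.
have dB : density B.
  split => //; rewrite BD raddf_sum /= -[RHS]/(1%:C) -p1 realc_sum; apply: eq_bigr => t _.
  by rewrite mxtraceZ (dA t).2 mulr1.
have [Y [b [YY YY' b0 b1 BE]]] := density_spectral dB.
pose q t k := complex.Re ((adj Y *m A t *m Y) k k).
have q0 t k : 0 <= q t k by apply: psd_diag_ge0; case: (dA t).
have bq k : b k = \sum_t p t * q t k.
  have -> : b k = complex.Re ((adj Y *m B *m Y) k k).
    by rewrite BE !mulmxA YY mul1mx -mulmxA YY mulmx1 !mxE eqxx mulr1n.
  rewrite BD mulmx_sumr mulmx_suml summxE Re_sum; apply: eq_bigr => t _.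
  by rewrite -scalemxAr -scalemxAl mxE ReMl.
have step t : 9 / 25 * (p t * nsq (\tr (W t *m (A t - B)))) <=
    p t * (- (ln 2 * entropy (A t)) - \sum_k q t k * ln (b k)).
  have [->|pt] := eqVneq (p t) 0; first by rewrite !mul0r mulr0.
  rewrite mulrCA; apply: ler_wpM2l => //; rewrite BE; apply: pinsker => // k bk.
  (* [b k] is the average of the [q t k], so where it vanishes so does [q t k] for every [t] of
     nonzero probability. *)
  have /eqP := bq k; rewrite bk eq_sym psumr_eq0; last by move=> i _; rewrite mulr_ge0.
  move=> /allP/(_ t); rewrite mem_index_enum => /(_ isT).
  by rewrite mulf_eq0 (negPf pt) /= => /eqP.
have h : 9 / 25 * \sum_t p t * nsq (\tr (W t *m (A t - B))) <=
    ln 2 * (entropy B - \sum_t p t * entropy (A t)).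
  rewrite mulr_sumr; apply: le_trans (ler_sum _ (fun t _ => step t)) _; apply: ler_of_eq.
  under eq_bigr do rewrite mulrBr mulrN.
  rewrite big_split /= addrC; rewrite mulrBr; congr (_ + _); last first.
    rewrite mulr_sumr sumrN; congr (- _); apply: eq_bigr => t _; exact: mulrCA.
  rewrite {1}BE entropy_diag // mulrN sumrN mulr_sumr; congr (- _).
  under eq_bigr do rewrite mulr_sumr.
  rewrite exchange_big; apply: eq_bigr => k _.
  rewrite [RHS]mulrCA log2_ln2; under eq_bigr do rewrite mulrA.
  by rewrite -mulr_suml -bq.
set X := \sum_t _ in h *; set Z := entropy B - _ in h *.
have X0 : 0 <= X by apply: sumr_ge0 => t _; rewrite mulr_ge0 ?nsq_ge0.
have l0 : 0 < ln 2 :> R by rewrite ln_gt0 // ltr1n.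
have l1 := ln2_le.
have Z0 : 0 <= Z.
  by rewrite -(pmulr_rge0 _ l0); apply: le_trans h; rewrite mulr_ge0 //; lra.
have := ler_wpM2r Z0 l1; lra.
Qed.

(** * Pure-state decompositions and the entanglement of formation *)

Definition mx_of m n (v : 'cV[C]_(m * n)) : 'M[C]_(m, n) :=
  \matrix_(i, j) v (mxtens_index (i, j)) 0.

Lemma sum_mxtens (V : nmodType) m n (f : 'I_(m * n) -> V) :
  \sum_k f k = \sum_i \sum_j f (mxtens_index (i, j)).
Proof.
rewrite pair_bigA /= (reindex (@mxtens_index m n)).
  by apply: eq_bigr => -[i j] _.
by exists (@mxtens_unindex m n) => k _; rewrite ?mxtens_indexK ?mxtens_unindexK.
Qed.

Lemma ptrace2_proj m n (v : 'cV[C]_(m * n)) :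
  ptrace2 (proj v) = mx_of v *m adj (mx_of v).
Proof.
apply/matrixP => i j; rewrite !mxE; apply: eq_bigr => k _.
by rewrite !mxE big_ord1 !mxE.
Qed.

Lemma ptrace2_sum m n (I : finType) (F : I -> 'M[C]_(m * n)) :
  ptrace2 (\sum_t F t) = \sum_t ptrace2 (F t).
Proof.
apply/matrixP => i j; rewrite mxE summxE; under eq_bigr do rewrite summxE.
by rewrite exchange_big; apply: eq_bigr => t _; rewrite mxE.
Qed.

Lemma ptrace2Z m n a (X : 'M[C]_(m * n)) : ptrace2 (a *: X) = a *: ptrace2 X.
Proof.
by apply/matrixP => i j; rewrite !mxE mulr_sumr; apply: eq_bigr => k _; rewrite mxE.
Qed.

Lemma tr_ptrace2 m n (X : 'M[C]_(m * n)) : \tr (ptrace2 X) = \tr X.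
Proof. by rewrite /mxtrace sum_mxtens; apply: eq_bigr => i _; rewrite mxE. Qed.

Lemma density_ptrace2_proj m n (v : 'cV[C]_(m * n)) :
  unit_vec v -> density (ptrace2 (proj v)).
Proof.
move=> uv; split; first by rewrite ptrace2_proj; apply: psd_mul_adj.
by rewrite tr_ptrace2 /proj mxtrace_mulC uv mxtrace1.
Qed.

(** Entropies of states are nonnegative, so the set of averages is bounded below and its infimum is
    below each member. Enumerating [I] gives the ordinal indexing of the definition. *)
Lemma ent_formation_le m n (s : 'M[C]_(m * n)) (I : finType) (p : I -> R)
    (psi : I -> 'cV[C]_(m * n)) :
  (forall t, 0 <= p t) -> \sum_t p t = 1 -> (forall t, unit_vec (psi t)) ->
  s = \sum_t (p t)%:C *: proj (psi t) ->
  ent_formation s <= \sum_t p t * entropy (ptrace2 (proj (psi t))).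
Proof.
move=> p0 p1 u sE; apply: ge_inf.
  exists 0 => x [k [p' [psi' [p0' _ u' _ ->]]]].
  by apply: sumr_ge0 => l _; rewrite mulr_ge0 // entropy_ge0 //; apply: density_ptrace2_proj.
have re (V : nmodType) (F : I -> V) : \sum_t F t = \sum_(l < #|I|) F (enum_val l).
  by rewrite (reindex (fun l : 'I_#|I| => enum_val l)) //=; apply: onW_bij; apply: enum_val_bij.
exists #|I|, (p \o enum_val), (psi \o enum_val); split => //=.
- by rewrite -re.
- by rewrite sE re.
- by rewrite re.
Qed.

(** The average entropy is at least [ent_formation s], which bounds the Holevo quantity;
    Cauchy-Schwarz passes from the mean square to the mean. As [W t] may vary with [t], this
    controls an average trace distance. *)
Lemma ensemble_le_ent_formation m n (s : 'M[C]_(m * n)) (I : finType) (p : I -> R)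
    (psi : I -> 'cV[C]_(m * n)) (W : I -> 'M[C]_m) :
  (forall t, 0 <= p t) -> \sum_t p t = 1 -> (forall t, unit_vec (psi t)) ->
  s = \sum_t (p t)%:C *: proj (psi t) -> (forall t, contraction (W t)) ->
  \sum_t p t * complex.Re (\tr (W t *m (ptrace2 (proj (psi t)) - ptrace2 s))) <=
  Num.sqrt (2 * (entropy (ptrace2 s) - ent_formation s)).
Proof.
move=> p0 p1 u sE cW.
have hB : ptrace2 s = \sum_t (p t)%:C *: ptrace2 (proj (psi t)).
  by rewrite sE ptrace2_sum; apply: eq_bigr => t _; rewrite ptrace2Z.
have := holevo_pinsker p0 p1 (fun t => density_ptrace2_proj (u t)) cW hB => h.
have {h} h : \sum_t p t * nsq (\tr (W t *m (ptrace2 (proj (psi t)) - ptrace2 s))) <=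
    2 * (entropy (ptrace2 s) - ent_formation s).
  by apply: le_trans h _; rewrite ler_pM2l // lerB // ent_formation_le.
set y := \sum_t _ in h *.
apply: le_trans (ler_norm _) _; rewrite -sqrtr_sqr ler_wsqrtr //.
apply: le_trans h.
have -> : \sum_t p t * complex.Re (\tr (W t *m (ptrace2 (proj (psi t)) - ptrace2 s))) =
  \sum_t Num.sqrt (p t) * (Num.sqrt (p t) * complex.Re (\tr (W t *m (ptrace2 (proj (psi t)) - ptrace2 s)))).
  by apply: eq_bigr => t _; rewrite mulrA -expr2 sqr_sqrtr.
apply: le_trans (sqr_sum_mul _ _) _.
under eq_bigr do rewrite sqr_sqrtr //; rewrite p1 mul1r /y.
apply: ler_sum => t _; rewrite exprMn sqr_sqrtr //.
by apply: ler_wpM2l => //; apply: sqr_Re_le_nsq.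
Qed.

End Entropy.

(** * Block matrices and random phases *)

Section Blocks.
Variable R : realType.
Local Notation C := (R[i]).

(** [stack A *m adj (stack A)] has blocks [A e *m adj (A f)]: the joint state of environment and
    reference, environment index first. *)
Definition stack D n m (A : 'I_D -> 'M[C]_(n, m)) : 'M[C]_(D * n, m) :=
  \matrix_(i, j) A (mxtens_unindex i).1 (mxtens_unindex i).2 j.

Lemma stackE D n m (A : 'I_D -> 'M[C]_(n, m)) e r j :
  stack A (mxtens_index (e, r)) j = A e r j.
Proof. by rewrite mxE mxtens_indexK. Qed.

Lemma adj_stack_mul D n m p (A : 'I_D -> 'M[C]_(n, m)) (B : 'I_D -> 'M[C]_(n, p)) :
  adj (stack A) *m stack B = \sum_e adj (A e) *m B e.
Proof.
apply/matrixP => i j; rewrite mxE sum_mxtens summxE; apply: eq_bigr => e _.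
by rewrite mxE; apply: eq_bigr => r _; rewrite !adjE !stackE.
Qed.

Lemma adj_stack_mul_mx D n m p (A : 'I_D -> 'M[C]_(n, m)) (B : 'I_D -> 'M[C]_(n, p))
    (U : 'M[C]_(D * n)) :
  adj (stack A) *m U *m stack B =
  \sum_e \sum_f adj (A e) *m mxblock_ij U e f *m B f.
Proof.
apply/matrixP => i j; rewrite mxE sum_mxtens summxE.
under [RHS]eq_bigr do rewrite summxE.
rewrite [RHS]exchange_big; apply: eq_bigr => f _.
under [RHS]eq_bigr do rewrite mxE.
rewrite [RHS]exchange_big; apply: eq_bigr => r _.
rewrite stackE -mulr_suml; congr (_ * _).
rewrite mxE sum_mxtens; apply: eq_bigr => e _; rewrite mxE; apply: eq_bigr => t _.
by rewrite !adjE stackE mxE.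
Qed.

Lemma tr_stack D n m (A : 'I_D -> 'M[C]_(n, m)) (U : 'M[C]_(D * n)) :
  \tr (U *m (stack A *m adj (stack A))) =
  \sum_e \sum_f \tr (mxblock_ij U e f *m (A f *m adj (A e))).
Proof.
rewrite mulmxA mxtrace_mulC mulmxA adj_stack_mul_mx raddf_sum; apply: eq_bigr => e _.
rewrite raddf_sum; apply: eq_bigr => f _.
by rewrite /= -mulmxA mxtrace_mulC -mulmxA.
Qed.

(** The sum is [adj J *m U *m J] for the isometry [J] that tensors with the environment vector
    [c]. *)
Lemma contraction_compress D n (U : 'M[C]_(D * n)) (c : 'I_D -> C) :
  contraction U -> \sum_e nsq (c e) = 1 ->
  contraction (\sum_e \sum_f (conjc (c e) * c f) *: mxblock_ij U e f).
Proof.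
move=> cU c1; pose J := stack (fun e => c e *: (1%:M : 'M[C]_n)).
have JJ : adj J *m J = 1%:M.
  rewrite adj_stack_mul; under eq_bigr do
    rewrite adjZ adj1 -scalemxAl mul1mx scalerA mulrC nsqE.
  by rewrite -scaler_suml -realc_sum c1 scale1r.
have -> : \sum_e \sum_f (conjc (c e) * c f) *: mxblock_ij U e f = adj J *m U *m J.
  rewrite adj_stack_mul_mx; apply: eq_bigr => e _; apply: eq_bigr => f _.
  by rewrite adjZ adj1 -scalemxAr mulmx1 -scalemxAl mul1mx scalerA mulrC.
apply: contraction_mul; last exact: contraction_isometry.
by apply: contraction_mul => //; apply: contraction_adj; apply: contraction_isometry.
Qed.

Lemma contraction_block D n (U : 'M[C]_(D * n)) e :
  contraction U -> contraction (mxblock_ij U e e).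
Proof.
move=> cU; have := @contraction_compress D n U (fun f => (f == e)%:R) cU.
rewrite (bigD1 e) //= eqxx nsq1 big1 ?addr0; last first.
  by move=> f /negPf->; rewrite nsq0.
move=> /(_ erefl); rewrite (bigD1 e) //= (bigD1 e) //= eqxx conjc1 mul1r scale1r.
rewrite big1 ?addr0; last by move=> f /negPf->; rewrite mulr0 scale0r.
rewrite big1 ?addr0 // => f /negPf->.
by rewrite big1 // => g _; rewrite conjc0 mul0r scale0r.
Qed.

End Blocks.

(** * Moments of random phases *)

Section RandomPhases.
Variable R : realType.
Local Notation C := (R[i]).
Variable D : nat.
Local Notation phases := {ffun 'I_D -> 'I_4}.

Definition im : C := 0 +i* 1.

(** Fourth roots of unity rather than signs: with signs the pairing [e = g], [f = h] would also
    survive in the fourth moment. *)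
Definition phase (z : phases) (e : 'I_D) : C := im ^+ z e.

Lemma im4 : im ^+ 4 = 1.
Proof. by rewrite (exprM _ 2 2) sqr_i sqrrN expr1n. Qed.

(** Conjugation becomes a cube, so products of phases are powers of [im] whose exponents are tested
    modulo 4. *)
Lemma conjc_im k : conjc (im ^+ k) = im ^+ (3 * k).
Proof.
rewrite rmorphXn exprM; congr (_ ^+ k).
by rewrite exprS sqr_i mulrN1; apply/eqP; rewrite eq_complex /= oppr0 !eqxx.
Qed.

Lemma nsq_im k : nsq (im ^+ k) = 1.
Proof. by elim: k => [|k IH]; rewrite ?expr0 ?nsq1 // exprS nsqM IH /nsq /= expr0n expr1n add0r mulr1. Qed.

Lemma sum_im_exp n : \sum_(k < 4) im ^+ (n * k) = if (4 %| n)%N then 4 else 0.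
Proof.
have red k : im ^+ (n * k) = im ^+ ((n %% 4) * k).
  by rewrite {1}(divn_eq n 4) mulnDl exprD -mulnAC [(_ * 4)%N]mulnC exprM im4 expr1n mul1r.
under eq_bigr do rewrite red.
have i2 : im ^+ 2 = -1 by exact: sqr_i.
have i3 : im ^+ 3 = - im by rewrite exprS i2 mulrN1.
have i6 : im ^+ 6 = -1 by rewrite (exprD _ 4 2) im4 mul1r.
have i9 : im ^+ 9 = im by rewrite (exprD _ 4 5) (exprD _ 4 1) im4 !mul1r.
rewrite /dvdn !big_ord_recl big_ord0 /=.
have : (n %% 4 < 4)%N by rewrite ltn_pmod.
case: (n %% 4)%N => [|[|[|[|//]]]] _ /=; rewrite /bump /= !addn0 ?mul0n ?muln0 ?mul1n ?muln1 ?expr0 ?expr1.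
- ring.
- rewrite -/(im ^+ 2) i2 i3; ring.
- by rewrite ?i2 -[(2 * 2)%N]/4%N -[(2 * 3)%N]/6%N im4 i6; ring.
- by rewrite ?i3 -[(3 * 2)%N]/6%N -[(3 * 3)%N]/9%N i6 i9; ring.
Qed.

(** The coordinates are independent, so the sum factors; one exponent not divisible by 4 annihilates
    it. *)
Lemma sum_phases (n : 'I_D -> nat) :
  \sum_(z : phases) \prod_x im ^+ (n x * z x) = if [forall x, (4 %| n x)%N] then 4 ^+ D else 0.
Proof.
rewrite -(bigA_distr_bigA (fun x k => im ^+ (n x * nat_of_ord k))) /=.
under eq_bigr do rewrite sum_im_exp.
case: forallP => [h|/forallP]; last first.
  rewrite negb_forall => /existsP[x /negPf hx].
  by rewrite (bigD1 x) //= hx mul0r.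
under eq_bigr do rewrite h.
by rewrite prodr_const card_ord.
Qed.

Lemma phase_prod k (z : phases) e : im ^+ (k * z e) = \prod_x im ^+ (k * (x == e) * z x).
Proof.
rewrite (bigD1 e) //= eqxx muln1 big1 ?mulr1 // => x /negPf->.
by rewrite muln0 mul0n expr0.
Qed.

Lemma phase_moment2 e f :
  \sum_(z : phases) (4 ^+ D)^-1 * (conjc (phase z e) * phase z f) = (e == f)%:R.
Proof.
have h (z : phases) : conjc (phase z e) * phase z f =
    \prod_x im ^+ ((3 * (x == e) + 1 * (x == f)) * z x).
  rewrite /phase conjc_im -[nat_of_ord (z f)]mul1n !phase_prod -big_split.
  by apply: eq_bigr => x _; rewrite /= -exprD -mulnDl.
rewrite -mulr_sumr (eq_bigr _ (fun z _ => h z)) sum_phases.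
have -> : [forall x, (4 %| 3 * (x == e) + 1 * (x == f))%N] = (e == f).
  apply/forallP/eqP => [/(_ e)|-> x]; last by case: (x == f).
  by rewrite eqxx; case: eqVneq.
case: eqP => _; last by rewrite mulr0.
by rewrite mulVf // expf_neq0 // pnatr_eq0.
Qed.

(** Each conjugated index must be paired with a plain one. If all four agree, both pairings hold,
    hence the subtraction. *)
Lemma phase_moment4 e f g h :
  \sum_(z : phases) (4 ^+ D)^-1 * (conjc (phase z e) * phase z f * (conjc (phase z g) * phase z h))
  = ((e == f) && (g == h))%:R + ((e == h) && (f == g))%:R
    - ([&& e == f, g == h & e == g])%:R.
Proof.
have pE (z : phases) : conjc (phase z e) * phase z f * (conjc (phase z g) * phase z h) =
    \prod_x im ^+ ((3 * (x == e) + 1 * (x == f) + (3 * (x == g) + 1 * (x == h))) * z x).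
  rewrite /phase !conjc_im -[nat_of_ord (z f)]mul1n -[nat_of_ord (z h)]mul1n !phase_prod -!big_split.
  by apply: eq_bigr => x _; rewrite /= -!exprD -!mulnDl.
rewrite -mulr_sumr (eq_bigr _ (fun z _ => pE z)) sum_phases.
(* A conjugated index contributes 3 and a plain one 1; testing the exponent at the four indices
   themselves forces a pairing. *)
have -> : [forall x, (4 %| 3 * (x == e) + 1 * (x == f) + (3 * (x == g) + 1 * (x == h)))%N] =
    ((e == f) && (g == h)) || ((e == h) && (f == g)).
  apply/forallP/idP => [hx|].
    have := hx e; have := hx f; have := hx g; have := hx h; rewrite !eqxx.
    rewrite ![_ == e]eq_sym ![_ == f]eq_sym ![h == g]eq_sym.
    by do 6!case: eqVneq => ? //=; subst; rewrite ?eqxx in *.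
  case/orP=> /andP[/eqP-> /eqP->] x; first by case: (x == f); case: (x == h).
  by case: (x == h); case: (x == g).
have n4 : (4 ^+ D : C) != 0 by rewrite expf_neq0 // pnatr_eq0.
have [->|ef] := eqVneq e f; have [->|gh] := eqVneq g h => /=.
- by rewrite mulVf // andbb addrK.
- have [fh|] := eqVneq f h; rewrite /= ?mulr0 ?addr0 ?subr0 //.
  by rewrite fh eq_sym (negPf gh) mulr0 addr0.
- have [eh|] := eqVneq e h; rewrite /= ?mulr0 ?addr0 ?subr0 //.
  by rewrite -eh eq_sym (negPf ef) mulr0 addr0.
- rewrite subr0 add0r; case: (_ && _); by rewrite ?mulr0 ?mulVf.
Qed.

Lemma phase_average (t : 'I_D -> 'I_D -> 'I_D -> 'I_D -> C) :
  \sum_(z : phases) (4 ^+ D)^-1 * (\sum_e \sum_f \sum_g \sum_h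
     conjc (phase z e) * phase z f * (conjc (phase z g) * phase z h) * t e f g h)
  = \sum_e \sum_g t e e g g + \sum_e \sum_f t e f f e - \sum_e t e e e e.
Proof.
have pull (V : 'I_D -> phases -> C) :
  \sum_z (4 ^+ D)^-1 * (\sum_e V e z) = \sum_e \sum_z (4 ^+ D)^-1 * V e z.
  by rewrite exchange_big; apply: eq_bigr => z _; rewrite mulr_sumr.
have delta (x : 'I_D) (F : 'I_D -> C) : \sum_y (x == y)%:R * F y = F x.
  rewrite (bigD1 x) //= eqxx mul1r big1 ?addr0 // => y.
  by rewrite eq_sym => /negPf->; rewrite mul0r.
rewrite pull; under eq_bigr do rewrite pull.
under eq_bigr do under eq_bigr do rewrite pull.
under eq_bigr do under eq_bigr do under eq_bigr do rewrite pull.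
have E e f g h : \sum_z (4 ^+ D)^-1 *
    (conjc (phase z e) * phase z f * (conjc (phase z g) * phase z h) * t e f g h) =
    (e == f)%:R * ((g == h)%:R * t e f g h) + (e == h)%:R * ((f == g)%:R * t e f g h)
    - (e == f)%:R * ((e == g)%:R * ((g == h)%:R * t e f g h)).
  transitivity ((\sum_z (4 ^+ D)^-1 *
    (conjc (phase z e) * phase z f * (conjc (phase z g) * phase z h))) * t e f g h).
    by rewrite mulr_suml; apply: eq_bigr => z _; rewrite -!mulrA.
  rewrite phase_moment4 mulrBl mulrDl -!mulnb !natrM -!mulrA.
  by rewrite [(g == h)%:R * ((e == g)%:R * _)]mulrCA.
under eq_bigr do under eq_bigr do under eq_bigr do under eq_bigr do rewrite E.
under eq_bigr do under eq_bigr do under eq_bigr do rewrite sumrB big_split /= -!mulr_sumr !delta.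
under eq_bigr do under eq_bigr do rewrite sumrB big_split /= -!mulr_sumr !delta.
by under eq_bigr do rewrite sumrB big_split /= !delta; rewrite sumrB big_split.
Qed.

End RandomPhases.

(** * Decoupling the reference from the environment *)

Section Decoupling.
Variable R : realType.
Local Notation C := (R[i]).

Lemma conjcM (x y : C) : conjc (x * y) = conjc x * conjc y.
Proof. exact: rmorphM. Qed.

Lemma mx_of_sum m n (I : finType) (c : I -> C) (v : I -> 'cV[C]_(m * n)) :
  mx_of (\sum_t c t *: v t) = \sum_t c t *: mx_of (v t).
Proof.
apply/matrixP => i j; rewrite mxE !summxE; apply: eq_bigr => t _.
by rewrite !mxE.
Qed.

Lemma proj_sum n (I : finType) (c : I -> C) (v : I -> 'cV[C]_n) :
  proj (\sum_t c t *: v t) = \sum_g \sum_h (c g * conjc (c h)) *: (v g *m adj (v h)).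
Proof.
rewrite /proj adj_sum mulmx_suml; apply: eq_bigr => g _.
rewrite mulmx_sumr; apply: eq_bigr => h _.
by rewrite adjZ -scalemxAl -scalemxAr scalerA.
Qed.

Lemma adj_sum_mul n (I : finType) (c : I -> C) (v : I -> 'cV[C]_n) :
  adj (\sum_t c t *: v t) *m (\sum_t c t *: v t) =
  \sum_g \sum_h (conjc (c g) * c h) *: (adj (v g) *m v h).
Proof.
rewrite adj_sum mulmx_suml; apply: eq_bigr => g _.
rewrite mulmx_sumr; apply: eq_bigr => h _.
by rewrite adjZ -scalemxAl -scalemxAr scalerA.
Qed.

(** * Measuring the environment in phase vectors and in the eigenbasis *)

Section Ensemble.
Variables (m n D : nat) (lam : 'I_D -> R) (u : 'I_D -> 'cV[C]_(m * n)).
Hypothesis lam0 : forall e, 0 <= lam e.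
Hypothesis lam1 : \sum_e lam e = 1.
Hypothesis ortho : forall e f, adj (u e) *m u f = ((e == f)%:R)%:M.

Let s := \sum_e (lam e)%:C *: proj (u e).
Let rho := ptrace2 s.
Let A e := (Num.sqrt (lam e))%:C *: mx_of (u e).
Let y := Num.sqrt (2 * (entropy rho - ent_formation s)).

Lemma AA_E e : A e *m adj (A e) = (lam e)%:C *: ptrace2 (proj (u e)).
Proof.
rewrite /A adjZ -scalemxAl -scalemxAr scalerA conjc_real -rmorphM -expr2 sqr_sqrtr //.
by rewrite ptrace2_proj.
Qed.

Lemma rho_sum : rho = \sum_e A e *m adj (A e).
Proof.
rewrite /rho /s ptrace2_sum; apply: eq_bigr => e _.
by rewrite ptrace2Z AA_E.
Qed.

Let unit_u e : unit_vec (u e).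
Proof. by rewrite /unit_vec ortho eqxx. Qed.

Lemma eigen_ensemble (W : 'I_D -> 'M[C]_m) : (forall e, contraction (W e)) ->
  \sum_e lam e * complex.Re (\tr (W e *m (ptrace2 (proj (u e)) - rho))) <= y.
Proof. by move=> cW; apply: ensemble_le_ent_formation. Qed.

Local Notation phases := {ffun 'I_D -> 'I_4}.
(** The state left when the environment purifying [s] is found in the phase vector [z]; all [z] are
    equally likely. *)
Let psi (z : phases) : 'cV[C]_(m * n) :=
  \sum_e (conjc (phase R z e) * (Num.sqrt (lam e))%:C) *: u e.

Let sum_delta (V : lmodType C) (e : 'I_D) (F : 'I_D -> V) :
  \sum_f (e == f)%:R *: F f = F e.
Proof.
rewrite (bigD1 e) //= eqxx scale1r big1 ?addr0 // => f.
by rewrite eq_sym => /negPf->; rewrite scale0r.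
Qed.

Let unit_psi z : unit_vec (psi z).
Proof.
rewrite /unit_vec /psi adj_sum_mul.
under eq_bigr => g _ do under eq_bigr => h _ do
  rewrite ortho -scalemx1 scalerA mulrC -scalerA.
under eq_bigr => g _ do rewrite sum_delta.
rewrite -scaler_suml -[RHS]scale1r; congr (_ *: _).
rewrite -[RHS]/(1%:C) -lam1 realc_sum; apply: eq_bigr => e _.
rewrite mulrC nsqE nsqM nsqC nsqJ nsq_im mul1r sqr_sqrtr //.
Qed.

Let sqrt2 e : (Num.sqrt (lam e))%:C * (Num.sqrt (lam e))%:C = (lam e)%:C.
Proof. by rewrite -rmorphM -expr2 sqr_sqrtr. Qed.

Let q : R := (4 ^+ D)^-1.
Let qC : q%:C = (4 ^+ D)^-1.
Proof. by rewrite /q fmorphV rmorphXn /= rmorph_nat. Qed.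

Let s_psi : s = \sum_(z : phases) q%:C *: proj (psi z).
Proof.
under eq_bigr do rewrite proj_sum scaler_sumr.
rewrite exchange_big; apply: eq_bigr => g _.
under eq_bigr do rewrite scaler_sumr.
rewrite exchange_big /=.
transitivity (\sum_h (g == h)%:R *: (((Num.sqrt (lam g))%:C * (Num.sqrt (lam h))%:C) *: (u g *m adj (u h)))).
  by rewrite sum_delta sqrt2.
apply: eq_bigr => h _; rewrite -phase_moment2 scaler_suml; apply: eq_bigr => z _.
rewrite !scalerA qC; congr (_ *: _).
rewrite conjcM conjc_real conjcK.
ring.
Qed.

Lemma phase_ensemble (W : phases -> 'M[C]_m) : (forall z, contraction (W z)) ->
  \sum_z q * complex.Re (\tr (W z *m (ptrace2 (proj (psi z)) - rho))) <= y.
Proof.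
move=> cW; apply: ensemble_le_ent_formation; [|  |exact: unit_psi|exact: s_psi|exact: cW].
  by move=> z; rewrite invr_ge0 exprn_ge0.
rewrite sumr_const card_ffun !card_ord -(mulr_natl q) natrX mulfV //.
by rewrite expf_neq0 // pnatr_eq0.
Qed.

Let rho_psi z : ptrace2 (proj (psi z)) =
  \sum_g \sum_h (conjc (phase R z g) * phase R z h) *: (A g *m adj (A h)).
Proof.
rewrite ptrace2_proj mx_of_sum adj_sum mulmx_suml; apply: eq_bigr => g _.
rewrite mulmx_sumr; apply: eq_bigr => h _.
rewrite /A !adjZ -!scalemxAl -!scalemxAr !scalerA; congr (_ *: _).
rewrite conjcM conjcK !conjc_real; ring.
Qed.

(* Random phases isolate the off-diagonal blocks; the diagonal ones are
   handled by the eigenensemble. *)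
Lemma decoupling_decomposition (U : 'M[C]_(D * m)) :
  \tr (U *m (stack A *m adj (stack A))) - \sum_e (lam e)%:C * \tr (mxblock_ij U e e *m rho) =
  \sum_(z : phases) q%:C * \tr ((\sum_e \sum_f (conjc (phase R z e) * phase R z f) *: mxblock_ij U e f)
     *m (ptrace2 (proj (psi z)) - rho)) +
  \sum_e (lam e)%:C * \tr (mxblock_ij U e e *m (ptrace2 (proj (u e)) - rho)).
Proof.
pose t e f g h : C := \tr (mxblock_ij U e f *m (A g *m adj (A h))).
pose Uz (z : phases) := \sum_e \sum_f (conjc (phase R z e) * phase R z f) *: mxblock_ij U e f.
have trUz (z : phases) M : \tr (Uz z *m M) =
    \sum_e \sum_f conjc (phase R z e) * phase R z f * \tr (mxblock_ij U e f *m M).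
  rewrite mulmx_suml raddf_sum; apply: eq_bigr => e _.
  rewrite mulmx_suml raddf_sum; apply: eq_bigr => f _.
  by rewrite /= -scalemxAl mxtraceZ.
(* Of the three sums from the fourth moment, the first cancels against the [rho] term ([S2], [S3]),
   the second is the trace sought ([S5]), and the third is restored by the eigenensemble ([S4]). *)
have S1 : \sum_(z : phases) q%:C * \tr (Uz z *m ptrace2 (proj (psi z))) =
    \sum_e \sum_g t e e g g + \sum_e \sum_f t e f f e - \sum_e t e e e e.
  rewrite -phase_average; apply: eq_bigr => z _; rewrite qC trUz; congr (_ * _).
  apply: eq_bigr => e _; apply: eq_bigr => f _.
  rewrite rho_psi mulmx_sumr raddf_sum mulr_sumr; apply: eq_bigr => g _.
  rewrite /= mulmx_sumr raddf_sum mulr_sumr; apply: eq_bigr => h _.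
  by rewrite /= -scalemxAr mxtraceZ mulrA.
have S2 : \sum_(z : phases) q%:C * \tr (Uz z *m rho) = \sum_e \tr (mxblock_ij U e e *m rho).
  under eq_bigr do rewrite trUz mulr_sumr.
  rewrite exchange_big; apply: eq_bigr => e _.
  under eq_bigr do rewrite mulr_sumr.
  rewrite exchange_big /=.
  rewrite -(@sum_delta C^o e (fun f => \tr (mxblock_ij U e f *m rho))).
  apply: eq_bigr => f _; rewrite -phase_moment2 -[RHS]/(_ * _) mulr_suml.
  by apply: eq_bigr => z _; rewrite qC mulrA.
have S3 : \sum_e \tr (mxblock_ij U e e *m rho) = \sum_e \sum_g t e e g g.
  by apply: eq_bigr => e _; rewrite rho_sum mulmx_sumr raddf_sum.
have S4 : \sum_e (lam e)%:C * \tr (mxblock_ij U e e *m ptrace2 (proj (u e))) = \sum_e t e e e e.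
  by apply: eq_bigr => e _; rewrite /t AA_E -scalemxAr mxtraceZ.
under [X in _ = X + _]eq_bigr => z _ do
  rewrite -/(Uz z) mulmxBr [\tr (_ - _)]raddfB mulrBr.
under [X in _ = _ + X]eq_bigr => e _ do rewrite mulmxBr [\tr (_ - _)]raddfB mulrBr.
have S5 : \tr (U *m (stack A *m adj (stack A))) = \sum_e \sum_f t e f f e.
  exact: (tr_stack A U).
clearbody t.
rewrite !sumrB /= S1 S2 S3 S4 S5.
move: (\sum_e \sum_f t e f f e) (\sum_e \sum_g t e e g g) (\sum_e t e e e e) => a b c.
move: (\sum_e (lam e)%:C * \tr (mxblock_ij U e e *m rho)) => d.
have E (a' b' c' d' : C) : a' - d' = b' + a' - c' - b' + (c' - d') by ring.
exact: E.
Qed.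

Lemma decoupling (U : 'M[C]_(D * m)) : contraction U ->
  complex.Re (\tr (U *m (stack A *m adj (stack A))) -
     \sum_e (lam e)%:C * \tr (mxblock_ij U e e *m rho)) <= (2 * D%:R - 1) * y.
Proof.
move=> cU.
have y0 : 0 <= y by apply: sqrtr_ge0.
have D0 : (0 < D)%N.
  rewrite lt0n; apply/eqP => DE; have := lam1; rewrite big1 => [/eqP|[i hi] _].
    by rewrite eq_sym oner_eq0.
  by exfalso; move: (hi); rewrite DE.
(* For [D = 1] there is a single block, and joint and product state coincide. *)
have [D1|D1] := leqP D 1.
  have Dr : D%:R = 1 :> R by have -> : D = 1%N by apply/eqP; rewrite eqn_leq D1 D0.
  have one e f : e = f :> 'I_D.
    apply: val_inj => /=; move: (ltn_ord e) (ltn_ord f); case: D D1 e f => [|[|]] //= _ [[|]] // ? [[|]] //.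
  have -> : \tr (U *m (stack A *m adj (stack A))) =
      \sum_e (lam e)%:C * \tr (mxblock_ij U e e *m rho).
    have l1 e : lam e = 1.
      by rewrite -lam1 (bigD1 e) //= big1 ?addr0 // => f; rewrite (one f e) eqxx.
    have r1 e : rho = A e *m adj (A e).
      by rewrite rho_sum (bigD1 e) //= big1 ?addr0 // => f; rewrite (one f e) eqxx.
    rewrite tr_stack; apply: eq_bigr => e _; rewrite l1 mul1r.
    by rewrite (bigD1 e) //= -r1 big1 ?addr0 // => f; rewrite (one f e) eqxx.
  by rewrite subrr /= Dr mulr_ge0 //; lra.
have Dr : (2 : R) <= D%:R by rewrite ler_nat.
(* Phase vectors have squared norm [D]; normalizing by [c] yields contractions [W z] at the price of
   a factor [D]. *)
set c := Num.sqrt (D%:R^-1 : R).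
have c2 : c ^+ 2 = D%:R^-1 by rewrite sqr_sqrtr // invr_ge0.
pose W (z : phases) := \sum_e \sum_f
  (conjc (c%:C * phase R z e) * (c%:C * phase R z f)) *: mxblock_ij U e f.
have cW z : contraction (W z).
  apply: contraction_compress => //.
  under eq_bigr do rewrite nsqM nsqC nsq_im mulr1 c2.
  by rewrite sumr_const card_ord -(mulr_natl (D%:R^-1 : R) D) mulfV // pnatr_eq0 -lt0n.
have WE z : \sum_e \sum_f (conjc (phase R z e) * phase R z f) *: mxblock_ij U e f = D%:R%:C *: W z.
  rewrite /W scaler_sumr; apply: eq_bigr => e _; rewrite scaler_sumr; apply: eq_bigr => f _.
  rewrite scalerA; congr (_ *: _); rewrite conjcM conjc_real.
  have : (D%:R : R)%:C * (c%:C * c%:C) = 1.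
    by rewrite -!rmorphM -expr2 c2 mulfV // pnatr_eq0 -lt0n.
  move=> h; rewrite -[LHS]mul1r -h; ring.
rewrite decoupling_decomposition ReD !Re_sum.
under eq_bigr => z _ do rewrite WE -scalemxAl mxtraceZ mulrCA !ReMl.
under [X in _ + X]eq_bigr do rewrite ReMl.
rewrite -mulr_sumr.
have h1 := phase_ensemble cW.
have h2 := eigen_ensemble (fun e => contraction_block e cU).
have D0r : 0 <= D%:R :> R by [].
have := ler_wpM2l D0r h1.
set X := _ * \sum_z _ in h1 *; set Z := \sum_e _ in h2 *; move=> h3.
(* The two bounds add up to [(D + 1) y], at most [(2 D - 1) y] since [D >= 2]. *)
nra.
Qed.

End Ensemble.
End Decoupling.

(** * Kraus operators and the recovery channel *)

Section Channels.
Variable R : realType.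
Local Notation C := (R[i]).

Definition kraus (I : finType) n n' (K : I -> 'M[C]_(n', n)) (X : 'M[C]_n) : 'M[C]_n' :=
  \sum_k K k *m X *m adj (K k).

(** [idtens] acts block by block; together with [mxblock_inj] this reduces its identities to those
    of [E]. *)
Lemma mxblock_idtens m n n' (E : 'M[C]_n -> 'M[C]_n') (X : 'M[C]_(m * n)) i j :
  mxblock_ij (idtens E X) i j = E (mxblock_ij X i j).
Proof.
apply/matrixP => a b; rewrite mxE /idtens summxE (bigD1 i) //= [X in _ + X]big1 ?addr0.
  rewrite summxE (bigD1 j) //= big1 ?addr0; first by rewrite tensmxE mxE !eqxx mul1r.
  by move=> l lj; rewrite tensmxE mxE eqxx eq_sym (negPf lj) mul0r.
move=> l li; rewrite summxE big1 // => l' _.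
by rewrite tensmxE mxE eq_sym (negPf li) mul0r.
Qed.

Lemma mxblock_inj m n (X Y : 'M[C]_(m * n)) :
  (forall i j, mxblock_ij X i j = mxblock_ij Y i j) -> X = Y.
Proof.
move=> h; apply/matrixP => k l; rewrite -(mxtens_unindexK k) -(mxtens_unindexK l).
case: (mxtens_unindex k) (mxtens_unindex l) => i a [j b].
by have /matrixP/(_ a b) := h i j; rewrite !mxE.
Qed.

Lemma mxblock_adj m n (X : 'M[C]_(m * n)) i j :
  mxblock_ij (adj X) i j = adj (mxblock_ij X j i).
Proof. by apply/matrixP => a b; rewrite !mxE. Qed.

Lemma idtens_comp m n n' n'' (E : 'M[C]_n -> 'M[C]_n') (F : 'M[C]_n' -> 'M[C]_n'')
    (X : 'M[C]_(m * n)) : idtens (F \o E) X = idtens F (idtens E X).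
Proof. by apply: mxblock_inj => i j; rewrite !mxblock_idtens. Qed.

Lemma ptrace2_idtens m n n' (E : 'M[C]_n -> 'M[C]_n') (X : 'M[C]_(m * n)) :
  (forall Y, \tr (E Y) = \tr Y) -> ptrace2 (idtens E X) = ptrace2 X.
Proof.
move=> trE; have tb k (Y : 'M[C]_(m * k)) i j : ptrace2 Y i j = \tr (mxblock_ij Y i j).
  by rewrite mxE; apply: eq_bigr => l _; rewrite mxE.
by apply/matrixP => i j; rewrite !tb mxblock_idtens trE.
Qed.

Definition subvec m n (x : 'cV[C]_(m * n)) (i : 'I_m) : 'cV[C]_n :=
  \col_a x (mxtens_index (i, a)) 0.

Lemma stack_subvec m n (x : 'cV[C]_(m * n)) : x = stack (subvec x).
Proof.
apply/matrixP => k j; rewrite -(mxtens_unindexK k); case: (mxtens_unindex k) => i a.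
by rewrite stackE mxE ord1.
Qed.

(** The vectors [y k] are the images of [x] under the adjoint Kraus operators on the second factor.
    The identity serves both complete positivity and the fidelity. *)
Lemma idtens_kraus_form m n n' (I : finType) (K : I -> 'M[C]_(n', n)) (X : 'M[C]_(m * n))
    (x : 'cV[C]_(m * n')) :
  let y k := stack (fun i => adj (K k) *m subvec x i) in
  adj x *m idtens (kraus K) X *m x = \sum_k adj (y k) *m X *m y k.
Proof.
move=> y; rewrite {1 2}(stack_subvec x) adj_stack_mul_mx.
under [RHS]eq_bigr do rewrite adj_stack_mul_mx.
rewrite [RHS]exchange_big; apply: eq_bigr => i _.
rewrite [RHS]exchange_big; apply: eq_bigr => j _.
rewrite mxblock_idtens mulmx_sumr mulmx_suml; apply: eq_bigr => k _.
by rewrite adjM adjK !mulmxA.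
Qed.

Lemma kraus_channel n n' (I : finType) (K : I -> 'M[C]_(n', n)) :
  \sum_k adj (K k) *m K k = 1%:M -> is_channel (kraus K).
Proof.
move=> K1; split.
- move=> a X Y; rewrite /kraus scaler_sumr -big_split; apply: eq_bigr => k _ /=.
  by rewrite mulmxDr mulmxDl -scalemxAr -scalemxAl.
- move=> m X [hX pX]; split.
    apply: mxblock_inj => i j; rewrite mxblock_adj !mxblock_idtens /kraus adj_sum.
    apply: eq_bigr => k _; rewrite !adjM adjK -mxblock_adj -hX mulmxA.
    by [].
  move=> x; rewrite idtens_kraus_form summxE.
  by apply: sumr_ge0 => k _; apply: pX.
- move=> X; rewrite /kraus raddf_sum /=.
  under eq_bigr do rewrite mxtrace_mulC mulmxA.
  by rewrite -[in LHS]raddf_sum -mulmx_suml K1 mul1mx.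
Qed.

(* The defect [1 - sum K^* K] is filled by Kraus operators preparing a fixed basis state. *)
Lemma kraus_completion D n n' (K : 'I_D -> 'M[C]_(n', n)) : (0 < n')%N ->
  contraction (stack K) ->
  exists L : 'I_n -> 'M[C]_(n', n),
    is_channel (kraus (fun k : 'I_D + 'I_n => match k with inl k => K k | inr i => L i end)).
Proof.
move=> n'0 cK.
have pS : psd (1%:M - \sum_k adj (K k) *m K k).
  split.
    rewrite adjB adj1 adj_sum; congr (_ - _); apply: eq_bigr => k _.
    by rewrite adjM adjK.
  move=> x; rewrite -adj_stack_mul mulmxBr mulmx1 mulmxBl.
  rewrite mulmxA -adjM -mulmxA.
  have entB (P Q : 'M[C]_1) : (P - Q) 0 0 = P 0 0 - Q 0 0 by rewrite !mxE.
  by rewrite entB !sqn_cVE -rmorphB ler0c subr_ge0.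
have [S pSS SS] := psd_sqrt pS.
exists (fun i => delta_mx (Ordinal n'0) i *m S); apply: kraus_channel.
rewrite big_sumType /=.
have -> : \sum_(i < n) adj (delta_mx (Ordinal n'0) i *m S) *m (delta_mx (Ordinal n'0) i *m S)
    = 1%:M - \sum_k adj (K k) *m K k.
  have dd i : adj (delta_mx (Ordinal n'0) i : 'M[C]_(n', n)) = delta_mx i (Ordinal n'0).
    by apply/matrixP => a b; rewrite !mxE conjc_nat andbC.
  under eq_bigr do rewrite adjM -pSS.1 dd -mulmxA (mulmxA (delta_mx _ _)) mul_delta_mx.
  rewrite -mulmx_sumr -mulmx_suml.
  have <- : 1%:M = \sum_(i < n) delta_mx i i :> 'M[C]_n.
    by rewrite -scalemx1 scale1r mx1_sum_delta.
  by rewrite mul1mx.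
by rewrite addrC subrK.
Qed.

End Channels.

(** * Recovery by an Uhlmann-type argument *)

Section Recovery.
Variable R : realType.
Local Notation C := (R[i]).

Lemma quad_mixture n (I : finType) (lam : I -> R) (u : I -> 'cV[C]_n) (x : 'cV[C]_n) :
  (adj x *m (\sum_e (lam e)%:C *: proj (u e)) *m x) 0 0 =
  (\sum_e lam e * nsq ((adj (u e) *m x) 0 0))%:C.
Proof.
rewrite mulmx_sumr mulmx_suml summxE realc_sum; apply: eq_bigr => e _.
rewrite -scalemxAr -scalemxAl mxE rmorphM; congr (_ * _).
have -> : adj x *m proj (u e) *m x = (adj x *m u e) *m (adj (u e) *m x).
  by rewrite /proj !mulmxA.
rewrite mxE big_ord1 mulrC -[RHS]/((nsq _)%:C) -nsqE; congr (_ * _).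
by rewrite -adjE adjM adjK.
Qed.

(* The Kraus operators are the blocks of the contraction [W *m adj V], where the
   square roots of the joint and product states factor as [S = stack A *m W] and
   [T = B *m V]. *)
Lemma recovery d d' D (lam : 'I_D -> R) (u : 'I_D -> 'cV[C]_(d * d')) (Psi : 'cV[C]_(d * d)) :
  (0 < d)%N -> (forall e, 0 <= lam e) -> \sum_e lam e = 1 ->
  (forall e f, adj (u e) *m u f = ((e == f)%:R)%:M) ->
  let s := \sum_e (lam e)%:C *: proj (u e) in
  ptrace2 s = ptrace2 (proj Psi) ->
  exists2 Rec : 'M[C]_d' -> 'M[C]_d, is_channel Rec &
    (1 - (2 * D%:R - 1) * Num.sqrt (2 * (entropy (ptrace2 s) - ent_formation s)))%:C
      <= (adj Psi *m idtens Rec s *m Psi) 0 0.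
Proof.
move=> d0 lam0 lam1 ortho s rhoE.
set y := Num.sqrt _.
have sqrt2 e : (Num.sqrt (lam e))%:C * (Num.sqrt (lam e))%:C = (lam e)%:C.
  by rewrite -rmorphM -expr2 sqr_sqrtr.
pose P := mx_of Psi.
pose A e := (Num.sqrt (lam e))%:C *: mx_of (u e).
(* Row block [e] of the square root of diag [lam] tensored with [P], so that [B *m adj B] is the
   product state. *)
pose Bl e : 'M[C]_(d, D * d) :=
  \matrix_(r, j) ((e == (mxtens_unindex j).1)%:R * (Num.sqrt (lam e))%:C * P r (mxtens_unindex j).2).
pose B := stack Bl.
set rho := ptrace2 s in rhoE y *.
have rhoP : rho = P *m adj P by rewrite rhoE ptrace2_proj.
have BB e f : Bl f *m adj (Bl e) = (e == f)%:R *: ((lam e)%:C *: rho).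
  apply/matrixP => r r'; rewrite mxE sum_mxtens.
  have [<-|ef] := eqVneq e f; last first.
    rewrite scale0r mxE big1 // => g _; rewrite big1 // => l _.
    rewrite adjE !mxE mxtens_indexK /= !conjcM conjc_nat.
    have [fg|] := eqVneq f g; last by rewrite !mul0r.
    by rewrite -fg (negPf ef) !mul0r mulr0.
  rewrite (bigD1 e) //= [X in _ + X]big1 ?addr0; last first.
    by move=> g; rewrite eq_sym => /negPf ge; rewrite big1 // => l _;
      rewrite !mxE mxtens_indexK /= ge !mul0r.
  rewrite scale1r rhoP !mxE mulr_sumr; apply: eq_bigr => l _.
  rewrite !adjE !mxE mxtens_indexK /= eqxx !conjcM conjc_nat conjc_real -sqrt2 !mulr1n.
  ring.
have trB U : \tr (U *m (B *m adj B)) = \sum_e (lam e)%:C * \tr (mxblock_ij U e e *m rho).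
  rewrite tr_stack; apply: eq_bigr => e _.
  rewrite (bigD1 e) //= BB eqxx scale1r -scalemxAr mxtraceZ big1 ?addr0 //.
  by move=> f; rewrite eq_sym => /negPf ef; rewrite BB ef scale0r mulmx0 mxtrace0.
have trrho : \tr rho = 1.
  rewrite tr_ptrace2 raddf_sum -[RHS]/(1%:C) -lam1 realc_sum; apply: eq_bigr => e _.
  by rewrite /= mxtraceZ mxtrace_mulC ortho eqxx mxtrace1 mulr1.
have rhoA : rho = \sum_e A e *m adj (A e) by apply: rho_sum.
have trA : \tr (stack A *m adj (stack A)) = 1.
  rewrite mxtrace_mulC adj_stack_mul raddf_sum -trrho rhoA raddf_sum.
  by apply: eq_bigr => e _; rewrite /= mxtrace_mulC.
have trBB : \tr (B *m adj B) = 1.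
  rewrite mxtrace_mulC adj_stack_mul raddf_sum -[RHS]/(1%:C) -lam1 realc_sum.
  apply: eq_bigr => e _; rewrite /= mxtrace_mulC BB eqxx scale1r mxtraceZ trrho mulr1.
  by [].
have [S pS SS] := psd_sqrt (psd_mul_adj (stack A)).
have [T pT TT] := psd_sqrt (psd_mul_adj B).
have [W cW SW] := sqrt_factor pS SS.
have [V cV TV] := sqrt_factor pT TT.
pose KK := W *m adj V.
have cKK : contraction KK by apply: contraction_mul => //; apply: contraction_adj.
(* Blocks are transposed: [stack K] is the transpose of [KK], again a contraction. *)
pose K e : 'M[C]_(d, d') := \matrix_(a, b) KK b (mxtens_index (e, a)).
have cK : contraction (stack K).
  have -> : stack K = map_mx conjc (adj KK).
    apply/matrixP => i j; rewrite -(mxtens_unindexK i); case: (mxtens_unindex i) => e a.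
    by rewrite stackE !mxE conjcK.
  by apply: contraction_conj; apply: contraction_adj.
have [L chL] := kraus_completion d0 cK.
set Kr := fun _ => _ in chL.
exists (kraus Kr) => //.
have BE e r f a : B (mxtens_index (e, r)) (mxtens_index (f, a)) =
    (e == f)%:R * (Num.sqrt (lam e))%:C * P r a by rewrite stackE mxE mxtens_indexK.
pose yv e := stack (fun i => adj (K e) *m subvec Psi i).
(* [T] is Hermitian, so [S *m T = stack A *m KK *m adj B]; as [B] is block diagonal, the trace only
   pairs [K e] with [u e]. *)
have overlap : \sum_e (lam e)%:C * (adj (u e) *m yv e) 0 0 = conjc (\tr (S *m T)).
  have -> : S *m T = stack A *m KK *m adj B by rewrite {1}pT.1 SW TV adjM /KK !mulmxA.
  rewrite /mxtrace sum_mxtens conjc_sum; apply: eq_bigr => e _.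
  rewrite {1}(stack_subvec (u e)) adj_stack_mul summxE mulr_sumr.
  rewrite conjc_sum.
  apply: eq_bigr => r _.
  rewrite [X in conjc X]mxE sum_mxtens (bigD1 e) //= [X in conjc (_ + X)]big1 ?addr0; last first.
    move=> f; rewrite eq_sym => /negPf ef; rewrite big1 // => a _.
    by rewrite adjE BE ef !mul0r conjc0 mulr0.
  rewrite conjc_sum mulmxA mxE mulr_sumr; apply: eq_bigr => a _.
  rewrite adjE BE eqxx mulr1n mul1r !conjcM !conjcK -sqrt2.
  have <- : (adj (subvec (u e) r) *m adj (K e)) 0 a * (Num.sqrt (lam e))%:C =
      conjc ((stack A *m KK) (mxtens_index (e, r)) (mxtens_index (e, a))).
    rewrite !mxE conjc_sum mulr_suml; apply: eq_bigr => b _.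
    rewrite stackE !mxE !conjcM conjc_real; ring.
  rewrite [subvec _ _ _ _]mxE [P r a]mxE; ring.
(* Discarding the completing operators [L] and all pairs of [K f] with [u e] for [f] other than [e]
   can only lower the fidelity. Cauchy-Schwarz with the weights [lam] bounds the rest by the squared
   overlap. *)
have fid : (nsq (\tr (S *m T)))%:C <= (adj Psi *m idtens (kraus Kr) s *m Psi) 0 0.
  rewrite idtens_kraus_form summxE big_sumType /=.
  under [X in _ <= X + _]eq_bigr do rewrite quad_mixture.
  under [X in _ <= _ + X]eq_bigr do rewrite quad_mixture.
  rewrite -!realc_sum -rmorphD lecR.
  set rest := \sum_(i < d') _.
  have rest0 : 0 <= rest.
    by apply: sumr_ge0 => i _; apply: sumr_ge0 => e _; rewrite mulr_ge0 ?nsq_ge0.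
  rewrite -nsqJ -overlap.
  apply: (@le_trans _ _ (\sum_e lam e * nsq ((adj (u e) *m yv e) 0 0))).
    under eq_bigr do rewrite -sqrt2 -mulrA.
    apply: le_trans (nsq_sum_mul _ _) _.
    under [X in X * _ <= _]eq_bigr do rewrite nsqC sqr_sqrtr //.
    rewrite lam1 mul1r; apply: ler_sum => e _.
    by rewrite nsqM nsqC sqr_sqrtr.
  rewrite -[leLHS]addr0; apply: lerD => //; apply: ler_sum => e _.
  rewrite (bigD1 e) //= lerDl.
  by apply: sumr_ge0 => f _; rewrite mulr_ge0 ?nsq_ge0.
apply: le_trans fid; rewrite lecR.
have [U cU hU] := powers_stormer pS pT.
have dec := decoupling lam0 lam1 ortho cU.
rewrite -/s -/rho -/y -trB -raddfB /= -mulmxBr -/A in dec.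
rewrite SS TT in hU.
have {hU dec} h := le_trans hU dec.
have STE : complex.Re (\tr ((S - T) *m (S - T))) = 2 - 2 * complex.Re (\tr (S *m T)).
  have trM (M N : 'M[C]_(D * d)) : \tr (M - N) = \tr M - \tr N by apply: raddfB.
  rewrite mulmxBl !mulmxBr !trM [\tr (T *m S)]mxtrace_mulC SS TT trA trBB !ReB /=.
  ring.
rewrite {}STE in h.
have y0 : 0 <= y by apply: sqrtr_ge0.
have D0 : 1 <= D%:R :> R.
  rewrite ler1n lt0n; apply/eqP => DE; have := lam1; rewrite big1 => [/eqP|[i hi] _].
    by rewrite eq_sym oner_eq0.
  by exfalso; move: (hi); rewrite DE.
set kk := (_ - 1) * y in h *.
have k0 : 0 <= kk by rewrite mulr_ge0 //; lra.
apply: le_trans (sqr_Re_le_nsq _).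
set g := complex.Re _ in h *.
(* From [2 - 2 g <= kk]: if [kk <= 2], then [g >= 1 - kk / 2 >= 0], and squaring gives
   [g ^+ 2 >= 1 - kk]. Otherwise the bound is negative. *)
have [k2|k2] := lerP kk 2; last first.
  by apply: le_trans (sqr_ge0 _); lra.
nra.
Qed.

Lemma tr_ptrace1 m n (X : 'M[C]_(m * n)) : \tr (ptrace1 X) = \tr X.
Proof.
rewrite /mxtrace sum_mxtens exchange_big; apply: eq_bigr => a _.
by rewrite mxE.
Qed.

(** With [M = mx_of Psi], the reductions are [M *m adj M] and the transpose of [adj M *m M]. This
    moves the entropy of the input to the reference, where decoupling is stated. *)
Lemma entropy_ptrace_proj n (Psi : 'cV[C]_(n * n)) :
  entropy (ptrace1 (proj Psi)) = entropy (ptrace2 (proj Psi)).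
Proof.
apply: entropy_char_poly; rewrite ptrace2_proj char_poly_mulC -char_poly_trmx.
congr char_poly; apply/matrixP => a b; rewrite !mxE; apply: eq_bigr => i _.
by rewrite !mxE big_ord1 !mxE mulrC.
Qed.

End Recovery.

Unset Implicit Arguments.

Theorem theorem1 (R : realType) (d d' : nat)
  (rho : 'M[R[i]]_d) (E : 'M[R[i]]_d -> 'M[R[i]]_d') (Psi : 'cV[R[i]]_(d * d)) :
  density rho ->
  is_channel E ->
  ptrace1 (proj Psi) = rho ->
  let rhoRQ' := idtens E (proj Psi) in
  let eps_f := entropy rho - ent_formation rhoRQ' in
  exists Rec : 'M[R[i]]_d' -> 'M[R[i]]_d,
    is_channel Rec /\
    (((1 - Num.sqrt (2 * (2 * d%:R * d'%:R - 1) ^+ 2 * eps_f))%:C)%C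
       <= ent_fidelity Psi (Rec \o E))%R.
Proof.
move=> drho [linE cpE trE] rhoE s eps.
have d0 : (0 < d)%N.
  rewrite lt0n; apply/eqP => dE; have := drho.2; rewrite /mxtrace big1 => [/eqP|[i hi] _].
    by rewrite eq_sym oner_eq0.
  by exfalso; move: (hi); rewrite dE.
have ps : psd s by apply: cpE; apply: psd_mul_adj.
have s2 : ptrace2 s = ptrace2 (proj Psi) by apply: ptrace2_idtens.
have trs : \tr s = 1 by rewrite -tr_ptrace2 s2 tr_ptrace2 -tr_ptrace1 rhoE drho.2.
(* All eigenvectors are kept, also those of eigenvalue 0, so the environment has dimension [d * d'],
   the product in the final constant. *)
have [V [lam [VV VV' lam0 lam1 sE]]] := density_spectral (conj ps trs).
pose u e := col e V.
have ortho e f : adj (u e) *m u f = ((e == f)%:R)%:M.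
  apply/matrixP => i j; rewrite !ord1 [RHS]mxE eqxx mulr1n.
  have /matrixP/(_ e f) := VV; rewrite [in RHS]mxE => <-.
  by rewrite !mxE; apply: eq_bigr => l _; rewrite !mxE.
have sU : \sum_e (lam e)%:C%C *: proj (u e) = s.
  rewrite sE; apply/matrixP => i j; rewrite diag_conj_entry summxE; apply: eq_bigr => e _.
  by rewrite !mxE big_ord1 !mxE mulrA.
have := recovery d0 lam0 lam1 ortho; rewrite /= sU => /(_ Psi s2)[Rec chRec].
rewrite s2 -entropy_ptrace_proj rhoE -/eps natrM.
set k := 2 * _ - 1; move=> h.
exists Rec; split => //.
rewrite /ent_fidelity idtens_comp -/s.
apply: le_trans h.
(* Nonnegativity lets [k ^+ 2] leave the square root as [k]. *)
have k0 : 0 <= k.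
  rewrite /k subr_ge0.
  have e0 : (0 < d * d')%N.
    rewrite lt0n; apply/eqP => DE; have := lam1; rewrite big1 => [/eqP|[i hi] _].
      by rewrite eq_sym oner_eq0.
    by exfalso; move: (hi); rewrite DE.
  have : (1 : R) <= (d * d')%:R by rewrite ler1n.
  rewrite natrM; lra.
have -> : 2 * (2 * d%:R * d'%:R - 1) ^+ 2 * eps = k ^+ 2 * (2 * eps).
  by rewrite /k; ring.
by rewrite sqrtrM ?sqr_ge0 // sqrtr_sqr ger0_norm.
Qed.
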